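(* Let $Y_{r,n}(0)$ be the $0$-Yokonuma-Hecke algebra over $\mathbb{K}$. Then $Y_{r,n}(0)$ is a standardly based algebra with standard basis $$\{E_\chi g_w \mid \chi\in\mathrm{Irr}(\mathcal{T}),\ w\in\mathfrak{S}_n\}.$$ Moreover, the simple modules of $Y_{r,n}(0)$ over $\mathbb{K}$ are all of dimension $1$, and their isomorphism classes are indexed by (i.e. are in bijection with) the set $$\big\{(\mathrm{c},\mathrm{J})=((c_1,\ldots,c_n),(J_1,\ldots,J_k))\ \big|\ \mathrm{c}\in C^n \text{ and } J_j \text{ is a composition of } |(I_{\mathrm{c}})_j| \text{ for } 1\le j\le k\big\},$$ where $C=\{1,\ldots,r\}$ and, for each $\mathrm{c}$, $k$ is the number of blocks of $I_{\mathrm{c}}=((I_{\mathrm{c}})_1,\ldots,(I_{\mathrm{c}})_k)$.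
   Context: Let $r,n\ge 1$ be integers and let $\mathbb{K}$ be an algebraically closed field of characteristic $p\ge 0$ such that $p$ does not divide $r$. $\mathfrak{S}_n$ is the symmetric group. The $0$-Yokonuma-Hecke algebra $Y_{r,n}(0)$ is the associative unital $\mathbb{K}$-algebra generated by $t_1,\ldots,t_n,g_1,\ldots,g_{n-1}$ subject to the relations: $t_i^r=1$ for $1\le i\le n$; $t_it_j=t_jt_i$ for $1\le i,j\le n$; $g_it_j=t_{s_i(j)}g_i$ for $1\le i\le n-1$, $1\le j\le n$, where $s_i$ is the transposition $(i,i+1)$; $g_ig_j=g_jg_i$ for $1\le i,j\le n-1$ with $|i-j|\ge 2$; $g_ig_{i+1}g_i=g_{i+1}g_ig_{i+1}$ for $1\le i\le n-2$; and $g_i^2=-e_ig_i$ for $1\le i\le n-1$, where $e_i:=\frac1r\sum_{s=0}^{r-1}t_i^st_{i+1}^{-s}$. For $w\in\mathfrak{S}_n$ with reduced expression $w=s_{i_1}\cdots s_{i_m}$, set $g_w:=g_{i_1}\cdots g_{i_m}$ (independent of the reduced expression). $\mathcal{T}$ is the commutative subalgebra generated by $t_1,\ldots,t_n$ (isomorphic to the group algebra of $(\mathbb{Z}/r\mathbb{Z})^n$), and $\mathrm{Irr}(\mathcal{T})$ is the set of its characters ($\mathbb{K}$-algebra homomorphisms $\mathcal{T}\to\mathbb{K}$). For $\chi\in\mathrm{Irr}(\mathcal{T})$, $E_\chi:=\prod_{i=1}^n\big(\frac1r\sum_{s=0}^{r-1}\chi(t_i)^st_i^{-s}\big)$ is the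 primitive idempotent of $\mathcal{T}$ associated to $\chi$, i.e. $\chi(E_\chi)=1$ and $\chi'(E_\chi)=0$ for $\chi'\ne\chi$. The elements $E_\chi g_w$ form a $\mathbb{K}$-basis of $Y_{r,n}(0)$. Standardly based algebra (Du-Rui): a $\mathbb{K}$-algebra $A$ is standardly based if there is a poset $\Lambda$ and, for each $\lambda\in\Lambda$, index sets $I(\lambda),J(\lambda)$ and a subset $A^\lambda=\{a^\lambda_{i,j}\mid (i,j)\in I(\lambda)\times J(\lambda)\}$ of $A$ such that (1) the union $\bigcup_{\lambda\in\Lambda}A^\lambda$ is disjoint and is a $\mathbb{K}$-basis of $A$; (2) for all $a\in A$, $\lambda\in\Lambda$ and $(i,j)\in I(\lambda)\times J(\lambda)$, $$a\cdot a^\lambda_{i,j}\equiv\sum_{i'\in I(\lambda)}f_{i',\lambda}(a,i)\,a^\lambda_{i',j}\pmod{A(>\lambda)},\qquad a^\lambda_{i,j}\cdot a\equiv\sum_{j'\in J(\lambda)}f_{\lambda,j'}(j,a)\,a^\lambda_{i,j'}\pmod{A(>\lambda)},$$ where $A(>\lambda)$ is the $\mathbb{K}$-span of all $A^\mu$ with $\mu>\lambda$, and the scalars $f_{i',\lambda}(a,i)\in\mathbb{K}$ do not depend on $j$ and the scalars $f_{\lambda,j'}(j,a)\in\mathbb{K}$ do not depend on $i$. A basis of this form is called a standard basis of $A$. For $\mathrm{c}=(c_1,\ldots,c_n)\in C^n$ with $C=\{1,\ldots,r\}$, the sequence $I_{\mathrm{c}}=((I_{\mathrm{c}})_1,\ldots,(I_{\mathrm{c}})_k)$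 is the decomposition of $\mathrm{c}$ into maximal constant consecutive blocks: there are $0=i_0<i_1<\cdots<i_k=n$ with $(I_{\mathrm{c}})_j=(c_{i_{j-1}+1},\ldots,c_{i_j})$, $c_{i_{j-1}+1}=\cdots=c_{i_j}$ for $1\le j\le k$, and $c_{i_j}\ne c_{i_j+1}$ for $1\le j\le k-1$. Put $|(I_{\mathrm{c}})_j|=i_j-i_{j-1}$. A composition of a positive integer $m$ is a finite sequence of positive integers with sum $m$. *)

(* Defs.v *)
From HB Require Import structures.
From mathcomp Require Import all_boot all_order all_algebra all_fingroup.
From mathcomp Require Import generic_quotient.
From mathcomp Require Import boolp classical_sets functions cardinality fsbigop.

Set Implicit Arguments.
Unset Strict Implicit.
Unset Printing Implicit Defensive.

Import GRing.Theory.

Local Open Scope ring_scope.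
Local Open Scope classical_set_scope.
Local Open Scope quotient_scope.

Section Span.
Variables (K : pzRingType) (V : lmodType K).

Definition lspan (S : set V) : set V :=
  [set x | exists (m : nat) (c : 'I_m -> K) (v : 'I_m -> V),
     (forall i, S (v i)) /\ x = \sum_i c i *: v i].

Definition lin_indep (S : set V) : Prop :=
  forall (m : nat) (c : 'I_m -> K) (v : 'I_m -> V),
    (forall i, S (v i)) -> injective v ->
    \sum_i c i *: v i = 0 -> forall i, c i = 0.

Definition is_basis (S : set V) : Prop := lin_indep S /\ lspan S = setT.

Definition has_dim (m : nat) : Prop :=
  exists v : 'I_m -> V, injective v /\ is_basis (range v).

End Span.

Section StandardBasis.
Variables (K : fieldType) (A : algType K).
Variables (d : Order.disp_t) (L : porderType d) (I J : L -> choiceType).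
Variable a : forall l : L, I l -> J l -> A.

Definition sb_cell (l : L) : set A := [set x | exists i j, x = a (l := l) i j].

Definition sb_above (l : L) : set A :=
  lspan [set x | exists2 m : L, (l < m)%O & sb_cell m x].

(* Injectivity of the family expresses that the union of the A^l is disjoint  *)
(* and that each A^l is indexed by I l * J l without repetition. *)
Definition sb_basis : Prop :=
  injective (fun p : {l : L & (I l * J l)%type} =>
               a (l := tag p) (tagged p).1 (tagged p).2) /\
  is_basis [set x | exists l, sb_cell l x].

(* The sums over I l and J l are sums of finitely supported families. The     *)
(* coefficient fL x i i' is the scalar f_{i',l}(x,i), and fR j x j' is the     *)
(* scalar f_{l,j'}(j,x). *)
Definition sb_left : Prop :=
  exists fL : forall l : L, A -> I l -> I l -> K,
  forall (x : A) (l : L) (i : I l), finite_set [set i' | fL l x i i' != 0] /\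
  forall j : J l,
    sb_above l (x * a i j - \sum_(i' \in [set: I l]) fL l x i i' *: a i' j).

Definition sb_right : Prop :=
  exists fR : forall l : L, J l -> A -> J l -> K,
  forall (x : A) (l : L) (j : J l), finite_set [set j' | fR l j x j' != 0] /\
  forall i : I l,
    sb_above l (a i j * x - \sum_(j' \in [set: J l]) fR l j x j' *: a i j').

End StandardBasis.

Definition standard_basis (K : fieldType) (A : algType K) (B : set A) : Prop :=
  exists (d : Order.disp_t) (L : porderType d) (I J : L -> choiceType)
         (a : forall l : L, I l -> J l -> A),
    [/\ sb_basis a, sb_left a, sb_right a &
        B = [set x | exists l, sb_cell a l x]].

Section Modules.
Variable A : pzRingType.

Definition simple_module (V : lmodType A) : Prop :=
  (exists v : V, v != 0) /\
  forall S : {pred V}, submod_closed S ->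
    (forall v, v \in S -> v = 0) \/ (forall v, v \in S).

Definition mod_iso (V W : lmodType A) : Prop :=
  exists f : {linear V -> W}, bijective f.

End Modules.

(* The K-vector space underlying a module over a K-algebra.                   *)
Definition res_scalars (K : fieldType) (A : algType K) (V : lmodType A) : Type := V.

Section Restrict.
Variables (K : fieldType) (A : algType K) (V : lmodType A).
HB.instance Definition _ := GRing.Zmodule.on (res_scalars V).

Definition res_scal_scale (k : K) (v : res_scalars V) : res_scalars V :=
  (k%:A : A) *: (v : V).

Fact res_scal_scalerA k l v :
  res_scal_scale k (res_scal_scale l v) = res_scal_scale (k * l) v.
Proof. by rewrite /res_scal_scale scalerA -scalerAl mul1r scalerA. Qed.
Fact res_scal_scale1r : left_id 1 res_scal_scale.
Proof. by move=> v; rewrite /res_scal_scale !scale1r. Qed.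
Fact res_scal_scalerDr : right_distributive res_scal_scale +%R.
Proof. by move=> k u v; rewrite /res_scal_scale -scalerDr. Qed.
Fact res_scal_scalerDl v : {morph res_scal_scale^~ v : k l / k + l}.
Proof. by move=> k l; rewrite /res_scal_scale !scalerDl. Qed.

HB.instance Definition _ := GRing.Zmodule_isLmodule.Build K (res_scalars V)
  res_scal_scalerA res_scal_scale1r res_scal_scalerDr res_scal_scalerDl.
End Restrict.

(* The index i of s_i = (i, i+1) and of g_i is counted from 0: i : 'I_n.-1. *)

Section SimpleReflections.
Variable n : nat.

Fact ord_hi_subproof (i : 'I_n.-1) : (i.+1 < n)%N.
Proof. by rewrite -ltn_predRL. Qed.

Definition ord_lo (i : 'I_n.-1) : 'I_n := widen_ord (leq_pred n) i.
Definition ord_hi (i : 'I_n.-1) : 'I_n := Ordinal (ord_hi_subproof i).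
Definition srefl (i : 'I_n.-1) : 'S_n := tperm (ord_lo i) (ord_hi i).

(* The composite s_{i_1} o ... o s_{i_m}. The word is reversed since the      *)
(* product of permutations in MathComp composes from left to right.           *)
Definition perm_of_word (s : seq 'I_n.-1) : 'S_n :=
  (\prod_(i <- rev s) srefl i)%g.

Definition reduced_expr (w : 'S_n) (s : seq 'I_n.-1) : Prop :=
  perm_of_word s = w /\
  forall s', perm_of_word s' = w -> (size s <= size s')%N.

Lemma perm_of_word_cat s1 s2 :
  perm_of_word (s1 ++ s2) = (perm_of_word s2 * perm_of_word s1)%g.
Proof. by rewrite /perm_of_word rev_cat big_cat. Qed.

Lemma perm_of_word_ex (w : 'S_n) : exists s, perm_of_word s = w.
Proof.
pose P (w : 'S_n) := exists s, perm_of_word s = w.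
have PM u v : P u -> P v -> P (u * v)%g.
  by move=> [s <-] [s' <-]; exists (s' ++ s); rewrite perm_of_word_cat.
have P1 : P 1%g by exists [::]; rewrite /perm_of_word big_nil.
have Ps i : P (srefl i) by exists [:: i]; rewrite /perm_of_word big_seq1.
suff Pt m (i j : 'I_n) : j = (i + m.+1)%N :> nat -> P (tperm i j).
  case: (prod_tpermP w) => ts -> dts.
  elim: ts dts => [|[i j] ts IH] /=; first by rewrite big_nil.
  move=> /andP[ij dts]; rewrite big_cons; apply: PM; last exact: IH.
  rewrite /= in ij *.
  have [lt_ij|lt_ji|/val_inj eij] := ltngtP i j; last by rewrite eij eqxx in ij.
  - by apply: (Pt (j - i).-1); rewrite prednK ?subn_gt0 // subnKC // ltnW.
  - rewrite tpermC; apply: (Pt (i - j).-1).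
    by rewrite prednK ?subn_gt0 // subnKC // ltnW.
elim: m i j => [|m IHm] i j eij.
  have i_lt : (i < n.-1)%N.
    by have := ltn_ord j; rewrite ltn_predRL eij addn1.
  have -> : tperm i j = srefl (Ordinal i_lt); last exact: Ps.
  by congr tperm; apply: val_inj => //=; rewrite eij addn1.
have j'_lt : (i + m.+1 < n.-1)%N.
  by have := ltn_ord j; rewrite ltn_predRL eij addnS.
pose k := Ordinal j'_lt.
have -> : tperm i j = (tperm i (ord_lo k) ^ srefl k)%g.
  have hk : ord_hi k = j by apply: val_inj; rewrite /= eij !addnS.
  have ij : j != i by rewrite -val_eqE /= eij addnS gtn_eqF // ltnS leq_addr.
  have ik : ord_lo k != i by rewrite -val_eqE /= addnS gtn_eqF // ltnS leq_addr.
  by rewrite tpermJ /srefl tpermL hk tpermD.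
rewrite /conjg; apply: (PM); first by rewrite tpermV; exact: Ps.
by apply: PM; [apply: (IHm i) | exact: Ps].
Qed.

Lemma reduced_expr_ex (w : 'S_n) : exists s, reduced_expr w s.
Proof.
have exm : exists m, `[< exists2 s, perm_of_word s = w & size s = m >].
  have [s sw] := perm_of_word_ex w.
  by exists (size s); apply/asboolP; exists s.
have [m /asboolP[s sw sm] min_m] := ex_minnP exm.
exists s; split=> // s' s'w; rewrite sm; apply: min_m.
by apply/asboolP; exists s'.
Qed.

Definition reduced_word (w : 'S_n) : seq 'I_n.-1 :=
  sval (cid (reduced_expr_ex w)).

End SimpleReflections.

(* Defining relations of the 0-Yokonuma--Hecke algebra. Since t_i ^ r = 1 and r > 0, the inverse of t_i   *)
(* is t_i ^ (r - 1).                                                          *)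

Definition YH_e (K : fieldType) (r n : nat) (A : algType K) (t : 'I_n -> A)
    (i : 'I_n.-1) : A :=
  r%:R^-1 *: \sum_(s < r) t (ord_lo i) ^+ s * (t (ord_hi i) ^+ r.-1) ^+ s.

Record YH_relations (K : fieldType) (r n : nat) (A : algType K)
    (t : 'I_n -> A) (g : 'I_n.-1 -> A) : Prop := {
  YH_t_exp : forall i, t i ^+ r = 1;
  YH_t_comm : forall i j, t i * t j = t j * t i;
  YH_g_t : forall i j, g i * t j = t (srefl i j) * g i;
  YH_g_comm : forall i j : 'I_n.-1, (i.+1 < j)%N || (j.+1 < i)%N ->
                g i * g j = g j * g i;
  YH_braid : forall i j : 'I_n.-1, j = i.+1 :> nat ->
                g i * g j * g i = g j * g i * g j;
  YH_quad : forall i, g i ^+ 2 = - (YH_e r t i * g i)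
}.

(* The algebra presented by these relations: terms in the generators modulo   *)
(* the congruence generated by the axioms of K-algebras and by the relations. *)
(* See YH_gens_relations and YH_lift for its universal property. *)

Section Presentation.
Variables (K : fieldType) (r n : nat).

Inductive YH_term : Type :=
| Yt of 'I_n
| Yg of 'I_n.-1
| Yscal of K
| Yadd of YH_term & YH_term
| Ymul of YH_term & YH_term.

HB.instance Definition _ := gen_eqMixin YH_term.
HB.instance Definition _ := gen_choiceMixin YH_term.

Fixpoint Yexp (x : YH_term) (m : nat) : YH_term :=
  if m is m'.+1 then Ymul x (Yexp x m') else Yscal 1.

Definition Ysum (m : nat) (F : nat -> YH_term) : YH_term :=
  foldr (fun s => Yadd (F s)) (Yscal 0) (iota 0 m).

Definition Ye (i : 'I_n.-1) : YH_term :=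
  Ymul (Yscal r%:R^-1)
    (Ysum r (fun s => Ymul (Yexp (Yt (ord_lo i)) s)
                           (Yexp (Yexp (Yt (ord_hi i)) r.-1) s))).

Local Notation "x +' y" := (Yadd x y) (at level 50, left associativity).
Local Notation "x *' y" := (Ymul x y) (at level 40, left associativity).

Inductive YH_eq : YH_term -> YH_term -> Prop :=
| Yeq_refl x : YH_eq x x
| Yeq_sym x y : YH_eq x y -> YH_eq y x
| Yeq_trans x y z : YH_eq x y -> YH_eq y z -> YH_eq x z
| Yeq_add x x' y y' : YH_eq x x' -> YH_eq y y' -> YH_eq (x +' y) (x' +' y')
| Yeq_mul x x' y y' : YH_eq x x' -> YH_eq y y' -> YH_eq (x *' y) (x' *' y')
| Yeq_addA x y z : YH_eq (x +' (y +' z)) (x +' y +' z)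
| Yeq_addC x y : YH_eq (x +' y) (y +' x)
| Yeq_add0 x : YH_eq (Yscal 0 +' x) x
| Yeq_mulA x y z : YH_eq (x *' (y *' z)) (x *' y *' z)
| Yeq_mul1 x : YH_eq (Yscal 1 *' x) x
| Yeq_mulDl x y z : YH_eq ((x +' y) *' z) (x *' z +' y *' z)
| Yeq_mulDr x y z : YH_eq (x *' (y +' z)) (x *' y +' x *' z)
| Yeq_mul0 x : YH_eq (Yscal 0 *' x) (Yscal 0)
| Yeq_scalD a b : YH_eq (Yscal (a + b)) (Yscal a +' Yscal b)
| Yeq_scalM a b : YH_eq (Yscal (a * b)) (Yscal a *' Yscal b)
| Yeq_scalC a x : YH_eq (Yscal a *' x) (x *' Yscal a)
| Yeq_t_exp i : YH_eq (Yexp (Yt i) r) (Yscal 1)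
| Yeq_t_comm i j : YH_eq (Yt i *' Yt j) (Yt j *' Yt i)
| Yeq_g_t i j : YH_eq (Yg i *' Yt j) (Yt (srefl i j) *' Yg i)
| Yeq_g_comm (i j : 'I_n.-1) : (i.+1 < j)%N || (j.+1 < i)%N ->
    YH_eq (Yg i *' Yg j) (Yg j *' Yg i)
| Yeq_braid (i j : 'I_n.-1) : j = i.+1 :> nat ->
    YH_eq (Yg i *' Yg j *' Yg i) (Yg j *' Yg i *' Yg j)
| Yeq_quad i : YH_eq (Yg i *' Yg i) (Yscal (-1) *' (Ye i *' Yg i)).

Definition YH_eqb : rel YH_term := fun x y => `[< YH_eq x y >].

Fact YH_eqb_equiv : equiv_class_of YH_eqb.
Proof.
split=> [x|x y|y x z].
- by apply/asboolP; constructor.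
- by apply/asboolP/asboolP; apply: Yeq_sym.
- by move=> /asboolP xy /asboolP yz; apply/asboolP; apply: Yeq_trans xy yz.
Qed.

Canonical YH_equiv := EquivRelPack YH_eqb_equiv.

Definition YH : Type := {eq_quot YH_eqb}.

HB.instance Definition _ := Choice.on YH.
HB.instance Definition _ := EqQuotient.on YH.

Lemma YH_piP (x y : YH_term) : \pi_YH x = \pi_YH y <-> YH_eq x y.
Proof.
split=> [/eqquotP|] h; first exact/asboolP.
by apply/eqquotP/asboolP.
Qed.

Lemma YH_repr (x : YH_term) : YH_eq (repr (\pi_YH x)) x.
Proof. by apply/YH_piP; rewrite reprK. Qed.

Definition YH_scal (a : K) : YH := \pi_YH (Yscal a).
Definition YH_add (x y : YH) : YH := \pi_YH (repr x +' repr y).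
Definition YH_mul (x y : YH) : YH := \pi_YH (repr x *' repr y).
Definition YH_opp (x : YH) : YH := YH_mul (YH_scal (-1)) x.
Definition YH_scale (a : K) (x : YH) : YH := YH_mul (YH_scal a) x.

Fact YH_addE x y : YH_add (\pi_YH x) (\pi_YH y) = \pi_YH (x +' y).
Proof. by apply/YH_piP; apply: Yeq_add; apply: YH_repr. Qed.
Fact YH_mulE x y : YH_mul (\pi_YH x) (\pi_YH y) = \pi_YH (x *' y).
Proof. by apply/YH_piP; apply: Yeq_mul; apply: YH_repr. Qed.

Fact YH_addA : associative YH_add.
Proof.
elim/quotW=> x; elim/quotW=> y; elim/quotW=> z.
rewrite (YH_addE y z) (YH_addE x y) 2!YH_addE; apply/YH_piP; exact: Yeq_addA.
Qed.
Fact YH_addC : commutative YH_add.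
Proof. by do 2![elim/quotW=> ?]; rewrite !YH_addE; apply/YH_piP; apply: Yeq_addC. Qed.
Fact YH_add0 : left_id (YH_scal 0) YH_add.
Proof. by elim/quotW=> ?; rewrite !YH_addE; apply/YH_piP; apply: Yeq_add0. Qed.
Fact YH_mulA : associative YH_mul.
Proof.
elim/quotW=> x; elim/quotW=> y; elim/quotW=> z.
rewrite (YH_mulE y z) (YH_mulE x y) 2!YH_mulE; apply/YH_piP; exact: Yeq_mulA.
Qed.
Fact YH_scalD a b : YH_scal (a + b) = YH_add (YH_scal a) (YH_scal b).
Proof. by rewrite YH_addE; apply/YH_piP; apply: Yeq_scalD. Qed.
Fact YH_scalM a b : YH_scal (a * b) = YH_mul (YH_scal a) (YH_scal b).
Proof. by rewrite YH_mulE; apply/YH_piP; apply: Yeq_scalM. Qed.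
Fact YH_scalC a x : YH_mul (YH_scal a) x = YH_mul x (YH_scal a).
Proof.
by elim/quotW: x => ?; rewrite !YH_mulE; apply/YH_piP; apply: Yeq_scalC.
Qed.
Fact YH_mul1 : left_id (YH_scal 1) YH_mul.
Proof. by elim/quotW=> ?; rewrite !YH_mulE; apply/YH_piP; apply: Yeq_mul1. Qed.
Fact YH_mulr1 : right_id (YH_scal 1) YH_mul.
Proof. by move=> x; rewrite -YH_scalC YH_mul1. Qed.
Fact YH_mul0 : left_zero (YH_scal 0) YH_mul.
Proof. by elim/quotW=> ?; rewrite !YH_mulE; apply/YH_piP; apply: Yeq_mul0. Qed.
Fact YH_mulr0 : right_zero (YH_scal 0) YH_mul.
Proof. by move=> x; rewrite -YH_scalC YH_mul0. Qed.
Fact YH_mulDl : left_distributive YH_mul YH_add.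
Proof.
elim/quotW=> x; elim/quotW=> y; elim/quotW=> z.
rewrite (YH_addE x y) (YH_mulE x z) (YH_mulE y z) YH_mulE YH_addE.
by apply/YH_piP; apply: Yeq_mulDl.
Qed.
Fact YH_mulDr : right_distributive YH_mul YH_add.
Proof.
elim/quotW=> x; elim/quotW=> y; elim/quotW=> z.
rewrite (YH_addE y z) (YH_mulE x y) (YH_mulE x z) YH_mulE YH_addE.
by apply/YH_piP; apply: Yeq_mulDr.
Qed.
Fact YH_addN : left_inverse (YH_scal 0) YH_opp YH_add.
Proof.
move=> x; rewrite -{2}[x]YH_mul1 /YH_opp -YH_mulDl -YH_scalD addNr.
exact: YH_mul0.
Qed.

HB.instance Definition _ :=
  GRing.isZmodule.Build YH YH_addA YH_addC YH_add0 YH_addN.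

HB.instance Definition _ := GRing.Zmodule_isPzRing.Build YH
  YH_mulA YH_mul1 YH_mulr1 YH_mulDl YH_mulDr.

Fact YH_scaleA a b (x : YH) :
  YH_scale a (YH_scale b x) = YH_scale (a * b) x.
Proof. by rewrite /YH_scale YH_mulA YH_scalM. Qed.
Fact YH_scale1 : left_id 1 YH_scale.
Proof. exact: YH_mul1. Qed.
Fact YH_scaleDr : right_distributive YH_scale +%R.
Proof. by move=> a x y; apply: YH_mulDr. Qed.
Fact YH_scaleDl (x : YH) : {morph YH_scale^~ x : a b / a + b}.
Proof. by move=> a b; rewrite /YH_scale YH_scalD YH_mulDl. Qed.

HB.instance Definition _ := GRing.Zmodule_isLmodule.Build K YH
  YH_scaleA YH_scale1 YH_scaleDr YH_scaleDl.

Section Eval.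
Variables (A : algType K) (t : 'I_n -> A) (g : 'I_n.-1 -> A).

Fixpoint YH_eval (x : YH_term) : A :=
  match x with
  | Yt i => t i
  | Yg i => g i
  | Yscal a => a%:A
  | Yadd x y => YH_eval x + YH_eval y
  | Ymul x y => YH_eval x * YH_eval y
  end.

Lemma YH_eval_exp x m : YH_eval (Yexp x m) = YH_eval x ^+ m.
Proof. by elim: m => [|m IHm] /=; rewrite ?expr0 ?scale1r ?exprS ?IHm. Qed.

Lemma YH_eval_sum m F : YH_eval (Ysum m F) = \sum_(s < m) YH_eval (F s).
Proof.
rewrite -(big_mkord xpredT (fun s => YH_eval (F s))) /index_iota subn0 /Ysum.
by elim: (iota 0 m) => [|s l IH] /=; rewrite ?big_nil ?scale0r ?big_cons ?IH.
Qed.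

Lemma YH_eval_e i : YH_eval (Ye i) = YH_e r t i.
Proof.
rewrite /= YH_eval_sum -scalerAl mul1r /YH_e; congr (_ *: _).
by apply: eq_bigr => s _; rewrite /= !YH_eval_exp.
Qed.

Hypothesis rels : YH_relations r t g.

Lemma YH_eval_eq x y : YH_eq x y -> YH_eval x = YH_eval y.
Proof.
elim=> {x y} //=.
- by move=> x y z _ -> _ ->.
- by move=> x x' y y' _ -> _ ->.
- by move=> x x' y y' _ -> _ ->.
- by move=> x y z; rewrite addrA.
- by move=> x y; rewrite addrC.
- by move=> x; rewrite scale0r add0r.
- by move=> x y z; rewrite mulrA.
- by move=> x; rewrite scale1r mul1r.
- by move=> x y z; rewrite mulrDl.
- by move=> x y z; rewrite mulrDr.
- by move=> x; rewrite scale0r mul0r.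
- by move=> a b; rewrite scalerDl.
- by move=> a b; rewrite -scalerAl mul1r scalerA.
- by move=> a x; rewrite -scalerAl -scalerAr mul1r mulr1.
- by move=> i; rewrite YH_eval_exp /= (YH_t_exp rels) scale1r.
- exact: (YH_t_comm rels).
- exact: (YH_g_t rels).
- exact: (YH_g_comm rels).
- exact: (YH_braid rels).
- move=> i; have /= -> := YH_eval_e i.
  by rewrite -scalerAl mul1r scaleN1r -expr2 (YH_quad rels).
Qed.

Lemma YH_eval_repr x : YH_eval (repr (\pi_YH x)) = YH_eval x.
Proof. exact/YH_eval_eq/YH_repr. Qed.

End Eval.

Fact YH_trivial_rels :
  YH_relations r (fun _ : 'I_n => 1 : K^o) (fun _ : 'I_n.-1 => 0 : K^o).
Proof.
by split=> *; rewrite ?expr1n ?mulr0 ?mul0r ?expr2 ?mulr0 ?mul0r ?oppr0.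
Qed.

Fact YH_neq0 : (1 : YH) != 0.
Proof.
apply/eqP => /YH_piP /(YH_eval_eq YH_trivial_rels) /= /eqP.
by rewrite scale1r scale0r oner_eq0.
Qed.

HB.instance Definition _ := GRing.PzSemiRing_isNonZero.Build YH YH_neq0.

Fact YH_scalerAl a (x y : YH) : a *: (x * y) = (a *: x) * y.
Proof. exact: YH_mulA. Qed.

HB.instance Definition _ := GRing.Lmodule_isLalgebra.Build K YH YH_scalerAl.

Fact YH_scalerAr a (x y : YH) : a *: (x * y) = x * (a *: y).
Proof.
by rewrite scalerAl; transitivity (x * YH_scal a * y);
  [congr (_ * _); apply: YH_scalC | rewrite -mulrA].
Qed.

HB.instance Definition _ := GRing.Lalgebra_isAlgebra.Build K YH YH_scalerAr.

Definition YH_t (i : 'I_n) : YH := \pi_YH (Yt i).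
Definition YH_g (i : 'I_n.-1) : YH := \pi_YH (Yg i).

Lemma YH_pi_eval (x : YH_term) : \pi_YH x = YH_eval YH_t YH_g x.
Proof.
elim: x => [i|i|a|x IHx y IHy|x IHx y IHy] //=.
- exact: (esym (YH_mulr1 _)).
- by rewrite -IHx -IHy; exact: (esym (YH_addE x y)).
- by rewrite -IHx -IHy; exact: (esym (YH_mulE x y)).
Qed.

Lemma YH_gens_relations : YH_relations r YH_t YH_g.
Proof.
have E x y : YH_eq x y -> YH_eval YH_t YH_g x = YH_eval YH_t YH_g y.
  by move=> /YH_piP; rewrite !YH_pi_eval.
split.
- by move=> i; have /= := E _ _ (Yeq_t_exp i); rewrite YH_eval_exp scale1r.
- by move=> i j; exact: (E _ _ (Yeq_t_comm i j)).
- by move=> i j; exact: (E _ _ (Yeq_g_t i j)).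
- by move=> i j ij; exact: (E _ _ (Yeq_g_comm ij)).
- by move=> i j ij; exact: (E _ _ (Yeq_braid ij)).
- move=> i; have /= := E _ _ (Yeq_quad i); have /= -> := YH_eval_e YH_t YH_g i.
  by rewrite -expr2 -scalerAl mul1r scaleN1r.
Qed.

Lemma YH_lift (A : algType K) (t : 'I_n -> A) (g : 'I_n.-1 -> A) :
  YH_relations r t g ->
  exists f : {lrmorphism YH -> A},
    [/\ forall i, f (YH_t i) = t i, forall i, f (YH_g i) = g i &
        forall f' : {lrmorphism YH -> A},
          (forall i, f' (YH_t i) = t i) -> (forall i, f' (YH_g i) = g i) ->
          f' =1 f].
Proof.
move=> rels; pose f (x : YH) := YH_eval t g (repr x).
have fE x : f (\pi_YH x) = YH_eval t g x by apply: YH_eval_repr.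
have fD x y : f (x + y) = f x + f y.
  elim/quotW: x => x; elim/quotW: y => y.
  by rewrite (fE x) (fE y); exact: (etrans (congr1 f (YH_addE x y)) (fE _)).
have fM x y : f (x * y) = f x * f y.
  elim/quotW: x => x; elim/quotW: y => y.
  by rewrite (fE x) (fE y); exact: (etrans (congr1 f (YH_mulE x y)) (fE _)).
have f1 : f 1 = 1 by exact: (etrans (fE (Yscal 1)) (scale1r _)).
have fZ a x : f (a *: x) = a *: f x.
  rewrite -[f x]mul1r scalerAl -[a *: 1](fE (Yscal a)).
  exact: (fM (\pi_YH (Yscal a)) x).
pose fl := GRing.isLinear.Build K YH A *:%R f
  (fun a x y => etrans (fD _ _) (congr1 (+%R^~ _) (fZ a x))).
pose fm := GRing.isMonoidMorphism.Build YH A f (conj f1 fM).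
pose F : {lrmorphism YH -> A} := HB.pack f fl fm.
exists F; split=> [i|i|f' ft fg]; [exact: fE | exact: fE |].
elim/quotW=> x; rewrite [RHS]fE YH_pi_eval.
elim: x => [i|i|a|x IHx y IHy|x IHx y IHy] /=.
- exact: ft.
- exact: fg.
- by rewrite linearZ /= rmorph1.
- by rewrite rmorphD /= IHx IHy.
- by rewrite rmorphM /= IHx IHy.
Qed.

Definition YH_T : {pred YH} := fun y =>
  `[< forall S : {pred YH}, subalg_closed S -> (forall i, YH_t i \in S) ->
      y \in S >].

Fact YH_T_subalg : subalg_closed YH_T.
Proof.
split.
- by apply/asboolP=> S [].
- move=> a x y /asboolP Tx /asboolP Ty; apply/asboolP=> S SS tS.
  by case: (SS) => _ + _; apply; [apply: Tx | apply: Ty].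
- move=> x y /asboolP Tx /asboolP Ty; apply/asboolP=> S SS tS.
  by case: (SS) => _ _; apply; [apply: Tx | apply: Ty].
Qed.

HB.instance Definition _ := GRing.isSubalgClosed.Build K YH YH_T
  (GRing.subalg_closed_semi YH_T_subalg).

Fact YH_t_in_T i : YH_t i \in YH_T.
Proof. by apply/asboolP. Qed.

Record YH_Tsub : Type := YHTsub { YH_Tval :> YH; _ : YH_Tval \in YH_T }.

HB.instance Definition _ := [isSub for YH_Tval].
HB.instance Definition _ := [Choice of YH_Tsub by <:].
HB.instance Definition _ := [SubChoice_isSubAlgebra of YH_Tsub by <:].

Definition YH_Tt (i : 'I_n) : YH_Tsub := YHTsub (YH_t_in_T i).

Definition IrrT : Type := {lrmorphism YH_Tsub -> K^o}.

Lemma IrrT_ext (chi chi' : IrrT) : chi =1 chi' -> chi = chi'.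
Proof.
move=> /funext; case: chi => f [[a] [b] [c]]; case: chi' => f' [[a'] [b'] [c']].
move=> /= ff'; case: _ / ff' a' b' c' => a' b' c'.
by rewrite (Prop_irrelevance a a') (Prop_irrelevance b b')
           (Prop_irrelevance c c').
Qed.

Definition YH_E (chi : IrrT) : YH :=
  \prod_(i < n)
    (r%:R^-1 *: \sum_(s < r) (chi (YH_Tt i) : K) ^+ s *: (YH_t i ^+ r.-1) ^+ s).

Definition YH_gword (s : seq 'I_n.-1) : YH := \prod_(i <- s) YH_g i.

(* g_w, computed from an arbitrarily chosen reduced expression of w. *)
Definition YH_gw (w : 'S_n) : YH := YH_gword (reduced_word w).

End Presentation.

Fixpoint blocks (T : eqType) (s : seq T) : seq (seq T) :=
  if s is x :: s' then
    if blocks s' is b :: B then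
      if ohead b == Some x then (x :: b) :: B else [:: x] :: b :: B
    else [:: [:: x]]
  else [::].

Lemma blocksP (T : eqType) (s : seq T) (x0 : T) :
  [/\ flatten (blocks s) = s,
      forall b, b \in blocks s -> b != [::] /\ constant b &
      sorted (fun b b' => last x0 b != head x0 b') (blocks s)].
Proof.
elim: s => [|x s [IHf IHc IHs]] //=.
case: (blocks s) IHf IHc IHs => [|[|y b] B] /= IHf IHc IHs.
- rewrite -IHf; split=> // b; rewrite inE => /eqP ->; split=> //.
- by have [] := IHc [::] (mem_head _ _).
have IHb := IHc _ (mem_head _ _); rewrite -IHf.
case: eqVneq => [[yx]|yx] /=; split=> //.
- move=> c; rewrite inE => /orP[/eqP ->|cB]; last first.
    by apply: IHc; rewrite inE cB orbT.
  by split=> //; case: IHb => _; rewrite /= yx eqxx.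
- by case: (B) IHs.
- by move=> c; rewrite inE => /orP[/eqP -> //|]; apply: IHc.
- by rewrite IHs andbT; apply: contraNneq yx => ->.
Qed.

Definition is_composition (m : nat) (J : seq nat) : bool :=
  all (fun x => 0 < x)%N J && (sumn J == m).

(* C = {1, ..., r} is represented by 'I_r. The predicate all2 also requires   *)
(* the number of compositions to be the number of blocks. *)
Definition is_simple_index (r n : nat) (cJ : n.-tuple 'I_r * seq (seq nat)) :
    bool :=
  all2 (fun b J => is_composition (size b) J) (blocks cJ.1) cJ.2.

Definition simple_index (r n : nat) : Type :=
  {cJ : n.-tuple 'I_r * seq (seq nat) | is_simple_index cJ}.

(* Main.v *)
Require Import Defs.
From HB Require Import structures.
From mathcomp Require Import all_boot all_order all_algebra all_fingroup.
From mathcomp Require Import generic_quotient cyclic separable cyclotomic.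
From mathcomp Require Import boolp classical_sets functions cardinality fsbigop.
From mathcomp Require Import zify.

Set Implicit Arguments.
Unset Strict Implicit.
Unset Printing Implicit Defensive.
Import GRing.Theory.
Local Open Scope ring_scope.
Local Open Scope classical_set_scope.

(** The theorem rests on one triangularity. Write E_c for the idempotent of a
    colouring c of the n positions by r-th roots of unity, and b(c, w) for
    E_c g_w. Each t_j scales b(c, w) from either side. Multiplying by g_i on
    the left has two outcomes: if s_i w is longer than w, the product is again
    a basis element, with permutation s_i w; otherwise g_w = g_i g_w' with w'
    shorter, so that g_i g_w = g_i^2 g_w' = - e_i g_w, and e_i multiplies every
    E_c by 1 or by 0. The same holds on the right. Hence multiplication by any element
    acts on b(c, w) by a scalar modulo the span of the b(d, u) with u longer
    than w ([triangular_mull], [triangular_mulr]). This is the standard basis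
    property, with one cell for each b(c, w) and cells ordered by length, as
    soon as the b(c, w) form a basis.

    They span because 1 is the sum of the E_c and their span is a left ideal
    ([yh_spanning]). They are independent because the algebra acts on functions
    of coloured words by the formulas of its regular representation, where the
    b(c, w) are told apart by evaluation ([yh_basis_free]). All of this
    supposes that g_w does not depend on the reduced expression of w, which is
    [matsumoto].

    The same triangularity gives the simple modules. If v is nonzero in a simple
    module, pick b(c, w) with b(c, w) v nonzero and w as long as possible: all
    longer basis elements kill v, so b(c, w) v is an eigenvector of the whole
    algebra ([simple_eigenvector]), its line is a submodule, and the module is
    given by a character. A character sends the t_j to r-th roots of unity,
    which is a colouring c; it sends g_i to 0 or -1, and to 0 if the colours of
    i and i + 1 differ ([character_g]). The places where g_i is sent to 0 cut
    each block of constant colour into parts, and these cuts are exactly the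
    compositions of the blocks ([compositions_cut], [compositions_exist],
    [cuts_inj], [compositions_inj]). *)

(** * Length of permutations *)

Section Length.
Variable n : nat.
Implicit Types (w : 'S_n) (i j : 'I_n.-1) (s : seq 'I_n.-1).
Local Open Scope group_scope.

Definition inversions w : {set 'I_n * 'I_n} :=
  [set p : 'I_n * 'I_n | (p.1 < p.2)%N && (w p.2 < w p.1)%N]%SET.
Definition len w : nat := #|inversions w|.

Lemma srefl_val i (a : 'I_n) : srefl i a =
  (if a == i :> nat then i.+1
   else if a == i.+1 :> nat then i : nat else a) :> nat.
Proof.
rewrite /srefl; case: tpermP => [->|->|/eqP ha /eqP hb] /=.
- by rewrite eqxx.
- by rewrite eqxx -[X in if X then _ else _]/(i.+1 == i)%N (gtn_eqF (ltnSn i)).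
- by rewrite -val_eqE /= in ha; rewrite -val_eqE /= in hb; rewrite (negPf ha)
  (negPf hb).
Qed.

Lemma srefl_lo i : srefl i (ord_lo i) = ord_hi i.
Proof. exact: tpermL. Qed.
Lemma srefl_hi i : srefl i (ord_hi i) = ord_lo i.
Proof. exact: tpermR. Qed.
Lemma sreflK i : involutive (srefl i).
Proof. exact: tpermK. Qed.
Lemma srefl2 i : srefl i * srefl i = 1.
Proof. exact: tperm2. Qed.
Lemma sreflKg i w : srefl i * (srefl i * w) = w.
Proof. by rewrite mulgA srefl2 mul1g. Qed.
Lemma sreflV i : (srefl i)^-1 = srefl i.
Proof. exact: tpermV. Qed.

Lemma len1 : len 1 = 0%N.
Proof.
apply/eqP; rewrite cards_eq0; apply/eqP/setP=> p.
by rewrite !inE !perm1; apply/negP; lia.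
Qed.

(** The reflection s_i only exchanges the order of the pair (i, i+1), so it maps
    the inversions of w injectively to inversions of the product, which has this
    pair as its one further inversion. *)
Lemma len_srefl_up i w : (w (ord_lo i) < w (ord_hi i))%N ->
  len (srefl i * w) = (len w).+1.
Proof.
move=> up; pose f (p : 'I_n * 'I_n) := (srefl i p.1, srefl i p.2).
have f_inj : injective f.
  by move=> [a b] [c d] [] /perm_inj -> /perm_inj ->.
rewrite /len; have -> : inversions (srefl i * w) =
    ((ord_lo i, ord_hi i) |: (f @: inversions w))%SET.
  apply/setP=> -[a b]; rewrite !inE /=.
  have -> : (a, b) = f (srefl i a, srefl i b) by rewrite /f /= !sreflK.
  rewrite (mem_imset _ _ f_inj) inE /= !permM.
  rewrite /f /= !sreflK xpair_eqE.
  have va := srefl_val i a; have vb := srefl_val i b.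
  have [e1|] := eqVneq a (ord_lo i); have [e2|] := eqVneq b (ord_hi i).
  - by rewrite e1 e2 srefl_lo srefl_hi /= ltnSn up.
  - rewrite e1 -val_eqE /= => nb; rewrite -e1; congr andb.
    rewrite {}e1 /= eqxx in va *; rewrite va vb; by repeat case: eqP; lia.
  - rewrite e2 -val_eqE /= => nb; rewrite -e2; congr andb.
    rewrite {}e2 /= in vb *; rewrite va vb; by repeat case: eqP; lia.
  - rewrite -!val_eqE /= => na nb; have [eab|nab] := eqVneq a b.
      by rewrite eab !ltnn.
    have : w (srefl i a) != w (srefl i b).
      by apply: contra nab => /eqP/perm_inj/perm_inj ->.
    have [e3|ne3] := eqVneq (a : nat) i.+1.
      have [e4|ne4] := eqVneq (b : nat) i.
        have -> : srefl i a = ord_lo i by apply: val_inj; rewrite /= va;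
          repeat case: eqP; lia.
        have -> : srefl i b = ord_hi i by apply: val_inj; rewrite /= vb;
          repeat case: eqP; lia.
        by lia.
      move=> _; congr andb; rewrite va vb; by repeat case: eqP; lia.
    move=> _; congr andb; rewrite va vb; by repeat case: eqP; lia.
rewrite cardsU1 card_imset // (_ : _ \notin _) //.
apply/negP=> /imsetP[[a b]]; rewrite inE /= => /andP[+ _] [ea eb].
have -> : a = ord_hi i by rewrite -(sreflK i a) -ea srefl_lo.
have -> : b = ord_lo i by rewrite -(sreflK i b) -eb srefl_hi.
by rewrite /=; lia.
Qed.

Lemma len_srefl_down i w : (w (ord_hi i) < w (ord_lo i))%N ->
  len w = (len (srefl i * w)).+1.
Proof.
move=> dn; rewrite -(@len_srefl_up i (srefl i * w)) ?sreflKg //.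
by rewrite !permM srefl_lo srefl_hi.
Qed.

Lemma up_or_down i w :
  (w (ord_lo i) < w (ord_hi i))%N || (w (ord_hi i) < w (ord_lo i))%N.
Proof.
rewrite -neq_ltn val_eqE (inj_eq perm_inj) -val_eqE /=.
by rewrite neq_ltn ltnSn.
Qed.

Lemma lenV w : len w^-1 = len w.
Proof.
pose f (p : 'I_n * 'I_n) := (w p.2, w p.1).
have f_inj : injective f by move=> [a b] [c d] [] /perm_inj -> /perm_inj ->.
rewrite /len -[RHS](card_imset _ f_inj); apply: eq_card => -[a b].
rewrite -[(a, b)](_ : f (w^-1 b, w^-1 a) = _); last first.
  by rewrite /f /= !permKV.
by rewrite (mem_imset _ _ f_inj) !inE /= !permKV andbC.
Qed.

(** A permutation that increases at each step satisfies a <= w a from the left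
    and w a <= a from the right. *)
Lemma exists_descent w : w != 1 ->
  exists i, (w (ord_hi i) < w (ord_lo i))%N.
Proof.
move=> w1; apply: contrapT => nex; case/eqP: w1.
have up i : (w (ord_lo i) < w (ord_hi i))%N.
  case/orP: (up_or_down i w) => // dn; case: nex; by exists i.
have ge m (a : 'I_n) : a = m :> nat -> (m <= w a)%N.
  elim: m a => // m IH a am.
  have mlt : (m < n.-1)%N by have := ltn_ord a; lia.
  have -> : a = ord_hi (Ordinal mlt) by apply: val_inj.
  by apply: leq_ltn_trans (up _); apply: IH.
have ge' m (a : 'I_n) : (a + m = n.-1)%N -> (w a + m <= n.-1)%N.
  elim: m a => [|m IH] a am; first by have := ltn_ord (w a); lia.
  have mlt : (a < n.-1)%N by lia.
  have ea : a = ord_lo (Ordinal mlt) by apply: val_inj.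
  have := up (Ordinal mlt); rewrite -ea.
  by have := IH (ord_hi (Ordinal mlt)); rewrite /=; lia.
apply/permP=> a; rewrite perm1; apply: val_inj => /=.
have := ge _ a erefl; have := ge' (n.-1 - a)%N a; have := ltn_ord a; lia.
Qed.

Lemma perm_of_word_cons i s : perm_of_word (i :: s) = perm_of_word s * srefl i.
Proof. by rewrite -cat1s perm_of_word_cat {2}/perm_of_word big_seq1. Qed.

Lemma perm_of_word_rcons i s : perm_of_word (rcons s i) = srefl i *
  perm_of_word s.
Proof. by rewrite -cats1 perm_of_word_cat {1}/perm_of_word big_seq1. Qed.

Lemma perm_of_word_nil : perm_of_word [::] = 1 :> 'S_n.
Proof. by rewrite /perm_of_word big_nil. Qed.

Lemma len_leq_size s : (len (perm_of_word s) <= size s)%N.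
Proof.
elim/last_ind: s => [|s i IH]; first by rewrite perm_of_word_nil len1.
rewrite perm_of_word_rcons size_rcons.
case/orP: (up_or_down i (perm_of_word s)) => [/len_srefl_up
  ->//|/len_srefl_down].
by lia.
Qed.

(** With [len_leq_size], this identifies the number of inversions with the
    minimal length of a word. *)
Lemma shortest_word w : exists2 s, perm_of_word s = w & size s = len w.
Proof.
have [m lwm] := ubnP (len w); elim: m w lwm => // m IH w lwm.
have [->|/exists_descent [i dn]] := eqVneq w 1.
  by exists [::]; rewrite ?perm_of_word_nil ?len1.
have lw := len_srefl_down dn.
have [|s sw ss] := IH (srefl i * w); first by lia.
by exists (rcons s i); rewrite ?perm_of_word_rcons ?size_rcons ?sw ?ss ?sreflKg.
Qed.

Lemma reduced_exprP w s :
  reduced_expr w s <-> perm_of_word s = w /\ size s = len w.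
Proof.
split=> -[sw h]; split=> //.
- have [s' s'w ss'] := shortest_word w.
  by have := h _ s'w; have := len_leq_size s; rewrite sw; lia.
- by move=> s' s'w; rewrite h -s'w; exact: len_leq_size.
Qed.

End Length.

(** * Independence of the reduced expression *)

Section Matsumoto.
Variable n : nat.
Implicit Types (w : 'S_n) (i j : 'I_n.-1) (s : seq 'I_n.-1).

Definition reduced s := size s == len (perm_of_word s).

Lemma reduced_rcons s i : reduced (rcons s i) =
  reduced s && (perm_of_word s (ord_lo i) < perm_of_word s (ord_hi i))%N.
Proof.
rewrite /reduced size_rcons perm_of_word_rcons.
have := len_leq_size s; set w := perm_of_word s.
case/orP: (up_or_down i w) => [up|dn].
  by rewrite (len_srefl_up up) up andbT eqSS.
by rewrite (len_srefl_down dn) => le; rewrite ltnNge (ltnW dn) andbF; lia.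
Qed.

Lemma srefl_commute i j : (i.+1 < j)%N ->
  (srefl i * srefl j = srefl j * srefl i)%g.
Proof.
move=> ij; apply/permP=> a; apply: val_inj; rewrite !permM /= !srefl_val.
by repeat case: eqP; lia.
Qed.

Lemma srefl_braid i j : j = i.+1 :> nat ->
  (srefl i * srefl j * srefl i = srefl j * srefl i * srefl j)%g.
Proof.
move=> ij; apply/permP=> a; apply: val_inj; rewrite !permM /= !srefl_val ij.
by repeat case: eqP; lia.
Qed.

Lemma srefl_fix i (a : 'I_n) : a != i :> nat -> a != i.+1 :> nat ->
  srefl i a = a.
Proof.
by move=> /negPf h1 /negPf h2; apply: val_inj; rewrite /= srefl_val h1 h2.
Qed.

Variables (A : pzRingType) (g : 'I_n.-1 -> A).
Hypothesis g_comm : forall i j : 'I_n.-1, (i.+1 < j)%N -> g i * g j = g j * g i.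
Hypothesis g_braid : forall i j : 'I_n.-1, j = i.+1 :> nat ->
  g i * g j * g i = g j * g i * g j.

Definition word_prod s := \prod_(i <- s) g i.

Lemma word_prod_rcons s i : word_prod (rcons s i) = word_prod s * g i.
Proof. by rewrite /word_prod big_rcons. Qed.

(** Induction on the length. If reduced words of w end in i and in j, then w has
    descents at both places. Hence, for some word c, both c i j and c j i are
    reduced words of w when i and j are far apart, and both c i j i and c j i j
    are when they are adjacent. The induction hypothesis compares the given
    words with these, and one relation among the generators does the rest. *)
Lemma matsumoto s s' : reduced s -> reduced s' ->
  perm_of_word s = perm_of_word s' -> word_prod s = word_prod s'.
Proof.
have [m] := ubnP (size s); elim: m s s' => // m IH s s' + rs rs' ss'.
have: size s = size s' by rewrite (eqP rs) (eqP rs') ss'.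
case/lastP: s => [|a i] in rs ss' *; case/lastP: s' => [|b j] in rs' ss' *;
  rewrite ?size_rcons // => -[sab] lam.
pose w := perm_of_word (rcons a i).
have wa : perm_of_word a = (srefl i * w)%g.
  by rewrite /w perm_of_word_rcons sreflKg.
have wb : perm_of_word b = (srefl j * w)%g.
  by rewrite /w ss' perm_of_word_rcons sreflKg.
have:= rs; rewrite reduced_rcons => /andP[ra]; rewrite wa !permM srefl_lo
  srefl_hi => di.
have:= rs'; rewrite reduced_rcons => /andP[rb]; rewrite wb !permM srefl_lo
  srefl_hi => dj.
have sa : size a = len (srefl i * w) by rewrite (eqP ra) wa.
have lw := len_srefl_down di.
clear rs rs' ss'; move: w => w in wa wb di dj sa lw *.
rewrite !word_prod_rcons.
have {}IH c d : (size c <= size a)%N -> reduced c -> reduced d ->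
    perm_of_word c = perm_of_word d -> word_prod c = word_prod d.
  by move=> ca; apply: IH; lia.
wlog le_ij : i j a b sab lam wa wb ra rb di dj sa lw IH / (i <= j)%N.
  move=> W; case: (leqP i j) => [|/ltnW] ij; first exact: W ij.
  have lw' := len_srefl_down dj.
  symmetry; apply: W ij => //; rewrite -?sab //.
  by rewrite sab (eqP rb) wb.
have [eij|nij] := eqVneq i j.
  by rewrite -eij in wb *; rewrite (IH a b) // wa wb.
have {le_ij nij} [far|near] : (i.+1 < j)%N \/ j = i.+1 :> nat.
  by move: nij; rewrite -val_eqE /=; lia.
- (* w = s_i s_j u with length two more than u *)
  pose u := (srefl j * (srefl i * w))%g.
  have [c cu sc] := shortest_word u.
  have fl : srefl i (ord_lo j) = ord_lo j by apply: srefl_fix => /=; lia.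
  have fh : srefl i (ord_hi j) = ord_hi j by apply: srefl_fix => /=; lia.
  have l2 : len (srefl i * w) = (len u).+1.
    by apply: len_srefl_down; rewrite !permM fl fh.
  have ea : perm_of_word (rcons c j) = perm_of_word a.
    by rewrite perm_of_word_rcons cu wa /u sreflKg.
  have eb : perm_of_word (rcons c i) = perm_of_word b.
    rewrite perm_of_word_rcons cu wb /u !mulgA -(mulgA (srefl i)).
    by rewrite -(srefl_commute far) mulgA srefl2 mul1g.
  rewrite (IH a (rcons c j)) ?(IH b (rcons c i)) ?word_prod_rcons //;
    rewrite /reduced ?ea ?eb ?size_rcons ?sc ?sab //.
  + by rewrite -mulrA -g_comm // mulrA.
  + by rewrite -(eqP rb) -sab sa l2.
  + by rewrite -(eqP ra) sa l2.
- (* the values of w at i, i+1, i+2 decrease, so w = s_i s_j s_i u with length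
     three more than u *)
  pose u := (srefl i * (srefl j * (srefl i * w)))%g.
  have [c cu sc] := shortest_word u.
  have eij : ord_lo j = ord_hi i by apply: val_inj; rewrite /= near.
  have fl : srefl j (ord_lo i) = ord_lo i by apply: srefl_fix => /=; lia.
  have fh : srefl i (ord_hi j) = ord_hi j by apply: srefl_fix => /=; lia.
  have sl : srefl j (ord_hi i) = ord_hi j by rewrite -eij srefl_lo.
  have l2 : len (srefl i * w) = (len (srefl j * (srefl i * w))%g).+1.
    apply: len_srefl_down; rewrite !permM eij srefl_hi fh.
    by apply: ltn_trans di; rewrite -eij.
  have l3 : len (srefl j * (srefl i * w)) = (len u).+1.
    by apply: len_srefl_down; rewrite !permM sl fl fh srefl_lo -eij.
  have ea : perm_of_word (rcons (rcons c i) j) = perm_of_word a.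
    by rewrite !perm_of_word_rcons cu wa /u !sreflKg.
  have eb : perm_of_word (rcons (rcons c j) i) = perm_of_word b.
    have uE : u = (srefl j * (srefl i * (srefl j * w)))%g.
      by rewrite /u !mulgA (srefl_braid near).
    by rewrite !perm_of_word_rcons cu wb uE !sreflKg.
  rewrite (IH a (rcons (rcons c i) j)) ?(IH b (rcons (rcons c j) i))
    ?word_prod_rcons //;
    rewrite /reduced ?ea ?eb ?size_rcons ?sc ?sab //.
  + by rewrite -!mulrA !(mulrA (g _)) g_braid.
  + by rewrite -(eqP rb) -sab sa l2 l3.
  + by rewrite -(eqP ra) sa l2 l3.
Qed.

End Matsumoto.

(** * Linear span *)

Section LinearSpan.
Variables (K : pzRingType) (V : lmodType K).
Implicit Types (S : set V) (P : V -> Prop).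

Lemma mem_lspan S x : S x -> lspan S x.
Proof.
move=> Sx; exists 1%N, (fun=> 1), (fun=> x); split=> //.
by rewrite big_ord1 scale1r.
Qed.

Lemma lspan0 S : lspan S 0.
Proof.
exists 0%N, (fun=> 1), (fun=> 0); split; last by rewrite big_ord0.
by case.
Qed.

Lemma lspanD S x y : lspan S x -> lspan S y -> lspan S (x + y).
Proof.
move=> [m [c [v [Sv ->]]]] [p [d [u [Su ->]]]].
exists (m + p)%N, (fun i => match fintype.split i with inl a => c a | inr a =>
  d a end),
  (fun i => match fintype.split i with inl a => v a | inr a => u a end).
split; first by move=> i; case: fintype.split.
rewrite big_split_ord; congr (_ + _); apply: eq_bigr => i _.
  by rewrite (unsplitK (inl i)).
by rewrite (unsplitK (inr i)).
Qed.

Lemma lspanZ S a x : lspan S x -> lspan S (a *: x).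
Proof.
move=> [m [c [v [Sv ->]]]]; exists m, (fun i => a * c i), v; split=> //.
by rewrite scaler_sumr; apply: eq_bigr => i _; rewrite scalerA.
Qed.

Lemma lspan_ind S P : P 0 -> (forall x y, P x -> P y -> P (x + y)) ->
  (forall a x, P x -> P (a *: x)) -> (forall x, S x -> P x) ->
  forall x, lspan S x -> P x.
Proof.
move=> P0 PD PZ PS x [m [c [v [Sv ->]]]].
by elim/big_ind: _ => // i _; apply/PZ/PS.
Qed.

Lemma lspan_sub S S' : S `<=` S' -> lspan S `<=` lspan S'.
Proof.
move=> SS'; apply: lspan_ind => [|x y|a x|x /SS'];
  [exact: lspan0 | exact: lspanD | exact: lspanZ | exact: mem_lspan].
Qed.

End LinearSpan.

(** Independence of a set is stated with families of distinct members of it; for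
    the range of a finite family it follows from the independence of the
    family, by collecting the coefficients along a choice of indices. *)
Lemma lin_indep_range (K : fieldType) (V : lmodType K) (I : finType)
    (b : I -> V) :
  (forall a : I -> K, \sum_i a i *: b i = 0 -> forall i, a i = 0) ->
  injective b /\ lin_indep (range b).
Proof.
move=> indep; split=> [x y bxy|m c v vb v_inj s0 k].
  apply/eqP/negPn/negP => xy.
  pose a i : K := (i == x)%:R - (i == y)%:R.
  suff /(indep a)/(_ x)/eqP : \sum_i a i *: b i = 0.
    by rewrite /a eqxx (negPf xy) subr0 oner_eq0.
  rewrite (bigD1 x) //= (bigD1 y) 1?eq_sym //= big1 ?addr0.
    by rewrite /a !eqxx (negPf xy) eq_sym (negPf xy) subr0 sub0r scale1r
      scaleN1r
      bxy subrr.
  move=> i /andP[ix iy]; by rewrite /a (negPf ix) (negPf iy) subrr scale0r.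
have /choice[h hb] : forall i : 'I_m, exists x, b x = v i.
  by move=> i; have [x _ e] := vb i; exists x.
pose a x := \sum_(i | h i == x) c i.
suff /(indep a)/(_ (h k)) : \sum_x a x *: b x = 0.
  rewrite /a (big_pred1 k) // => i; apply/eqP/eqP => [e|-> //].
  by apply: v_inj; rewrite -!hb e.
rewrite -[RHS]s0 (partition_big h xpredT) //=; apply: eq_bigr => x _.
by rewrite scaler_suml; apply: eq_bigr => i /eqP <-; rewrite hb.
Qed.

(** * Idempotents of commuting roots of unity *)

Section CommutingIdempotents.
Variables (K : fieldType) (r n : nat) (A : algType K) (t : 'I_n -> A).
Variable zeta : K.
Hypothesis t_exp : forall i, t i ^+ r = 1.
Hypothesis t_comm : forall i j, t i * t j = t j * t i.
Hypothesis zeta_prim : r.-primitive_root zeta.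
Hypothesis r_neq0 : r%:R != 0 :> K.
Implicit Types (i j : 'I_n) (z : 'I_n -> K) (c : {ffun 'I_n -> 'I_r}).

Let r_gt0 : (0 < r)%N. Proof. exact: prim_order_gt0 zeta_prim. Qed.

Definition eigen_proj i (x : K) : A :=
  r%:R^-1 *: \sum_(s < r) x ^+ s *: (t i ^+ r.-1) ^+ s.

Definition joint_proj z : A := \prod_(i < n) eigen_proj i (z i).

(** With u the inverse of t_i, multiplication by t_i sends x^s u^s to
    x (x^(s-1) u^(s-1)), and the term s = 0 to that of s = r - 1. *)
Lemma eigen_projP i x : x ^+ r = 1 ->
  t i * eigen_proj i x = x *: eigen_proj i x.
Proof.
move=> xr; rewrite /eigen_proj -scalerAr scalerA mulrC -scalerA; congr (_ *: _).
have tu : t i * t i ^+ r.-1 = 1 by rewrite -exprS prednK.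
(* u^(r-1) is the inverse of u *)
have ut : (t i ^+ r.-1) ^+ r.-1 = t i.
  have e : t i ^+ r.-1 * (t i ^+ r.-1) ^+ r.-1 = 1.
    by rewrite -exprS prednK // exprAC t_exp expr1n.
  by rewrite -[LHS]mul1r -tu -mulrA e mulr1.
move: (t i) (t i ^+ r.-1) tu ut xr => T U.
case: r r_gt0 => // m _ /= TU UT xm.
rewrite [in LHS]big_ord_recl [in RHS]big_ord_recr /= mulrDr !expr0 scale1r
  mulr1 addrC.
rewrite scalerDr scalerA -exprS xm scale1r UT; congr (_ + _).
rewrite mulr_sumr scaler_sumr; apply: eq_bigr => s _.
by rewrite /bump /= add1n exprS -scalerA -!scalerAr exprS mulrA TU mul1r.
Qed.

Lemma eigen_proj_comm i j x : t j * eigen_proj i x = eigen_proj i x * t j.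
Proof.
rewrite /eigen_proj -scalerAr -scalerAl; congr (_ *: _).
rewrite mulr_sumr mulr_suml; apply: eq_bigr => s _.
rewrite -scalerAr -scalerAl; congr (_ *: _).
by do 2!apply: commrX; apply: t_comm.
Qed.

Lemma joint_proj_comm z j : t j * joint_proj z = joint_proj z * t j.
Proof. by apply: commr_prod => i _; apply: eigen_proj_comm. Qed.

Lemma joint_projl z j : z j ^+ r = 1 ->
  t j * joint_proj z = z j *: joint_proj z.
Proof.
move=> zr; rewrite /joint_proj; have: j \in index_enum 'I_n by exact:
  mem_index_enum.
elim: index_enum => // i s IH; rewrite !big_cons inE mulrA.
case: eqVneq => [<- _|_ /= /IH e]; first by rewrite eigen_projP // scalerAl.
by rewrite eigen_proj_comm -mulrA e scalerAr.
Qed.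

Lemma joint_projr z j : z j ^+ r = 1 ->
  joint_proj z * t j = z j *: joint_proj z.
Proof. by rewrite -joint_proj_comm; apply: joint_projl. Qed.

Lemma geometric_sum0 (x : K) : x ^+ r = 1 -> x != 1 -> \sum_(s < r) x ^+ s = 0.
Proof.
move=> xr x1; have /eqP := subrX1 x r; rewrite xr subrr eq_sym mulf_eq0.
by rewrite subr_eq0 (negPf x1) => /eqP.
Qed.

Lemma sum_eigen_proj i : \sum_(k < r) eigen_proj i (zeta ^+ k) = 1.
Proof.
rewrite -scaler_sumr exchange_big /= (bigD1 (Ordinal r_gt0)) //= [X in _ +
  X]big1 ?addr0.
  rewrite (eq_bigr (fun=> 1)) => [|k _]; last by rewrite !expr0 scale1r.
  by rewrite sumr_const card_ord -scaler_nat scalerA mulVf ?scale1r.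
move=> s s0; rewrite -scaler_suml (eq_bigr (fun k : 'I_r => (zeta ^+ s) ^+ k)).
  rewrite geometric_sum0 ?scale0r //.
    by rewrite exprAC (prim_expr_order zeta_prim) expr1n.
  rewrite -(expr0 zeta) (eq_prim_root_expr zeta_prim) mod0n modn_small //.
by move=> k _; rewrite exprAC.
Qed.

(** This is the scalar by which e_i acts on a vector with colours a and b at the
    places i and i + 1. *)
Lemma colour_orthogonality (a b : 'I_r) :
  r%:R^-1 * (\sum_(s < r) (zeta ^+ a * (zeta ^+ b) ^+ r.-1) ^+ s) =
  (a == b)%:R :> K.
Proof.
have exp_r m : (zeta ^+ m) ^+ r = 1.
  by rewrite exprAC (prim_expr_order zeta_prim) expr1n.
set x := zeta ^+ a * _; have xr : x ^+ r = 1.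
  by rewrite /x exprMn exp_r mul1r (exprAC _ r.-1) exp_r expr1n.
have b1 : zeta ^+ b * (zeta ^+ b) ^+ r.-1 = 1 by rewrite -exprS prednK.
case: (eqVneq a b) => [e|ne].
  rewrite (eq_bigr (fun=> 1)) => [|s _]; last by rewrite /x e b1 expr1n.
  by rewrite sumr_const card_ord mulVf.
rewrite geometric_sum0 ?mulr0 //; apply: contra ne => /eqP x1;
  apply/eqP/val_inj/eqP.
have /eqP : zeta ^+ a = zeta ^+ b.
  by rewrite -[LHS]mulr1 -b1 mulrCA -/x x1 mulr1.
by rewrite (eq_prim_root_expr zeta_prim) !modn_small.
Qed.

Definition colour_root c i : K := zeta ^+ c i.

Lemma colour_root_exp c i : colour_root c i ^+ r = 1.
Proof. by rewrite /colour_root exprAC (prim_expr_order zeta_prim) expr1n. Qed.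

Lemma colour_root_inj c d : colour_root c =1 colour_root d -> c = d.
Proof.
move=> e; apply/ffunP=> i; apply/val_inj/eqP.
have /eqP := e i; rewrite /colour_root (eq_prim_root_expr zeta_prim).
by rewrite !modn_small.
Qed.

Definition colour_idem c : A := joint_proj (colour_root c).

Lemma sum_colour_idem : \sum_c colour_idem c = 1.
Proof.
transitivity (\prod_(i < n) \sum_(k < r) eigen_proj i (zeta ^+ k)).
  by rewrite bigA_distr_bigA.
by rewrite big1 // => i _; apply: sum_eigen_proj.
Qed.

(** If the colours differ at j, then E_c t_j y is computed in two ways with two
    different scalars, so E_c y = 0; the remaining term of the sum of all
    idempotents must then fix y. This avoids any computation inside E_c. *)
Lemma colour_idem_eigen c d y :
  (forall j, t j * y = colour_root d j *: y) ->
  colour_idem c * y = if c == d then y else 0.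
Proof.
have ne e : (forall j, t j * y = colour_root d j *: y) -> e != d ->
    colour_idem e * y = 0.
  move=> ty /eqP ed; have [j zj] : exists j, colour_root e j != colour_root d j.
    by apply: contrapT => /forallNP h; apply: ed; apply: colour_root_inj => j;
      apply/eqP/negPn/negP/h.
  have : colour_idem e * t j * y = colour_idem e * (t j * y) by rewrite mulrA.
  rewrite joint_projr ?colour_root_exp // ty -scalerAl -scalerAr => /eqP.
  by rewrite -subr_eq0 -scalerBl scaler_eq0 subr_eq0 (negPf zj) => /eqP.
move=> ty; case: eqVneq => [->|cd]; last exact: ne.
rewrite -[RHS]mul1r -sum_colour_idem (bigD1 d) //= mulrDl mulr_suml.
by rewrite big1 ?addr0 // => e ed; apply: ne.
Qed.

End CommutingIdempotents.

(** * Triangularity of multiplication *)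

Section YHInduction.
Variables (K : fieldType) (r n : nat).
Local Notation Y := (YH K r n).

Lemma YH_ind (P : Y -> Prop) :
  (forall i, P (YH_t K r i)) -> (forall i, P (YH_g K r i)) ->
  (forall a, P a%:A) -> (forall x y, P x -> P y -> P (x + y)) ->
  (forall x y, P x -> P y -> P (x * y)) -> forall y, P y.
Proof.
move=> Pt Pg Pa PD PM; elim/quotW=> x; rewrite YH_pi_eval.
by elim: x => /=; auto.
Qed.

End YHInduction.

Section YHBasis.
Variables (K : fieldType) (r n : nat) (zeta : K).
Hypothesis zeta_prim : r.-primitive_root zeta.
Hypothesis r_neq0 : r%:R != 0 :> K.
Local Notation Y := (YH K r n).
Local Notation t := (@YH_t K r n).
Local Notation g := (@YH_g K r n).
Local Notation rels := (YH_gens_relations K r n).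
Implicit Types (i : 'I_n.-1) (j : 'I_n) (w : 'S_n) (s : seq 'I_n.-1).
Implicit Types (c d : {ffun 'I_n -> 'I_r}) (y : Y).

Definition colour_act (u : 'S_n) c : {ffun 'I_n -> 'I_r} := [ffun j => c (u j)].

Lemma colour_act1 c : colour_act 1%g c = c.
Proof. by apply/ffunP=> j; rewrite ffunE perm1. Qed.

Lemma colour_actM u v c :
  colour_act (u * v)%g c = colour_act u (colour_act v c).
Proof. by apply/ffunP=> j; rewrite !ffunE permM. Qed.

Lemma colour_root_act u c j :
  colour_root zeta (colour_act u c) j = colour_root zeta c (u j).
Proof. by rewrite /colour_root ffunE. Qed.

Definition idem c : Y := colour_idem t zeta c.

Lemma idem_tl c j : t j * idem c = colour_root zeta c j *: idem c.
Proof.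
apply: (joint_projl (YH_t_exp rels) (YH_t_comm rels) zeta_prim).
exact: colour_root_exp.
Qed.

Lemma idem_tr c j : idem c * t j = colour_root zeta c j *: idem c.
Proof.
apply: (joint_projr (YH_t_exp rels) (YH_t_comm rels) zeta_prim).
exact: colour_root_exp.
Qed.

Lemma sum_idem : \sum_c idem c = 1.
Proof. exact: (sum_colour_idem t zeta_prim r_neq0). Qed.

Lemma idem_eigen c d y : (forall j, t j * y = colour_root zeta d j *: y) ->
  idem c * y = if c == d then y else 0.
Proof.
exact: (colour_idem_eigen (YH_t_exp rels) (YH_t_comm rels) zeta_prim r_neq0).
Qed.

Lemma idem_mul c d : idem c * idem d = if c == d then idem c else 0.
Proof. by rewrite (idem_eigen _ (idem_tl d)); case: eqP => // ->. Qed.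

(** g_i E_d is a common eigenvector of the t_j with the colours of d moved by
    s_i, so only the term d = s_i c survives when 1 is expanded as the sum of
    the idempotents on both sides. *)
Lemma idem_g c i : idem c * g i = g i * idem (colour_act (srefl i) c).
Proof.
rewrite -[X in _ = X]mulr1 -[LHS]mulr1 -sum_idem !mulr_sumr.
apply: eq_bigr => d _; rewrite -[LHS]mulrA -[RHS]mulrA idem_mul.
rewrite (@idem_eigen c (colour_act (srefl i) d)); last first.
  move=> j; rewrite mulrA -{1}(sreflK i j) -(YH_g_t rels) -mulrA idem_tl.
  by rewrite -scalerAr colour_root_act.
have -> : (c == colour_act (srefl i) d) = (colour_act (srefl i) c == d).
  apply/eqP/eqP=> [->|<-]; by rewrite -colour_actM srefl2 colour_act1.
by case: eqP => [->|]; rewrite ?mulr0.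
Qed.

Lemma g_idem c i : g i * idem c = idem (colour_act (srefl i) c) * g i.
Proof. by rewrite idem_g -colour_actM srefl2 colour_act1. Qed.

Lemma idem_word c s : idem c * YH_gword K r s =
  YH_gword K r s * idem (colour_act (perm_of_word s) c).
Proof.
elim: s c => [|i s IH] c.
  by rewrite /YH_gword big_nil mulr1 mul1r perm_of_word_nil colour_act1.
rewrite {1 2}/YH_gword big_cons mulrA idem_g -!mulrA IH.
by rewrite perm_of_word_cons colour_actM.
Qed.

Lemma idem_e c i : idem c * YH_e r t i =
  if c (ord_lo i) == c (ord_hi i) then idem c else 0.
Proof.
have tX j m : idem c * t j ^+ m = colour_root zeta c j ^+ m *: idem c.
  elim: m => [|m IH]; first by rewrite !expr0 mulr1 scale1r.
  by rewrite exprSr mulrA IH -scalerAl idem_tr scalerA exprSr.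
transitivity ((c (ord_lo i) == c (ord_hi i))%:R *: idem c).
  rewrite -(colour_orthogonality zeta_prim r_neq0) /YH_e -scalerAr -scalerA;
    congr (_ *: _).
  rewrite mulr_sumr scaler_suml; apply: eq_bigr => s _.
  by rewrite mulrA tX -exprM -scalerAl tX scalerA exprM -exprMn.
by case: eqP; rewrite ?scale1r ?scale0r.
Qed.

Lemma gw_word s : reduced s -> YH_gword K r s = YH_gw K r (perm_of_word s).
Proof.
move=> rs; rewrite /YH_gw /reduced_word.
case: cid => s' /= /reduced_exprP [s's ls'].
apply: matsumoto => //; last by rewrite /reduced s's ls'.
- by move=> i j ij; apply: (YH_g_comm rels); rewrite ij.
- by move=> i j; apply: (YH_braid rels).
Qed.

Lemma gw1 : YH_gw K r (1 : 'S_n)%g = 1.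
Proof.
rewrite -(perm_of_word_nil n) -gw_word ?/YH_gword ?big_nil //.
by rewrite /reduced perm_of_word_nil len1.
Qed.

Lemma idem_gw c w : idem c * YH_gw K r w = YH_gw K r w * idem (colour_act w c).
Proof.
have [s <- ss] := shortest_word w.
rewrite -gw_word; first exact: idem_word.
by rewrite /reduced ss.
Qed.

Lemma gw_up_right w i : (w (ord_lo i) < w (ord_hi i))%N ->
  YH_gw K r w * g i = YH_gw K r (srefl i * w)%g.
Proof.
have [s <- /eqP ss] := shortest_word w; move=> up.
rewrite -perm_of_word_rcons -!gw_word ?reduced_rcons ?up ?andbT //.
by rewrite [RHS]/YH_gword big_rcons.
Qed.

(** Permutations are multiplied from left to right, so the usual product s_i w
    is written w * s_i. *)
Lemma gw_up_left w i : (w^-1 (ord_lo i) < w^-1 (ord_hi i))%g%N ->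
  g i * YH_gw K r w = YH_gw K r (w * srefl i)%g.
Proof.
have [s <- /eqP ss] := shortest_word w; move=> up.
rewrite -perm_of_word_cons -!gw_word //; first by rewrite [RHS]/YH_gword
  big_cons.
rewrite /reduced /= perm_of_word_cons -lenV invMg sreflV len_srefl_up // lenV.
by rewrite (eqP ss).
Qed.

Definition yh_basis (x : {ffun 'I_n -> 'I_r} * 'S_n) : Y :=
  idem x.1 * YH_gw K r x.2.

Definition longer (m : nat) : set Y :=
  lspan (yh_basis @` [set x | (m <= len x.2)%N]).

Lemma longer_basis m c w : (m <= len w)%N -> longer m (yh_basis (c, w)).
Proof. by move=> mw; apply: mem_lspan; exists (c, w). Qed.

Lemma longer_sub m p : (m <= p)%N -> longer p `<=` longer m.
Proof.
move=> mp; apply: lspan_sub => _ [x /= px <-]; exists x => //.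
exact: leq_trans px.
Qed.

(** A linear map of this kind preserves the filtration by length, and in the
    graded pieces the basis elements are its eigenvectors. *)
Definition triangular (f : Y -> Y) : Prop :=
  forall x, exists a, longer (len x.2).+1 (f (yh_basis x) - a *: yh_basis x).

Lemma triangular_longer f m : linear f -> triangular f ->
  forall y, longer m y -> longer m (f y).
Proof.
move=> lf tf.
have f0 : f 0 = 0 by have := lf (-1) 0 0; rewrite scaler0 addr0 scaleN1r addNr.
apply: lspan_ind => [|x y fx fy|a x fx|_ [x /= mx <-]].
- by rewrite f0; apply: lspan0.
- by have := lf 1 x y; rewrite !scale1r => ->; apply: lspanD.
- by have := lf a x 0; rewrite !addr0 f0 addr0 => ->; apply: lspanZ.
have [a fa] := tf x; rewrite -[f _](subrK (a *: yh_basis x)).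
apply: lspanD; last by apply: lspanZ; case: x mx {fa} => c w; apply:
  longer_basis.
by apply: longer_sub fa; apply: leqW.
Qed.

Lemma triangularD f h : triangular f -> triangular h -> triangular (f \+ h).
Proof.
move=> tf th x; have [a fa] := tf x; have [b hb] := th x.
by exists (a + b); rewrite scalerDl opprD addrACA; apply: lspanD.
Qed.

Lemma triangular_comp f h : linear f -> triangular f -> triangular h ->
  triangular (f \o h).
Proof.
move=> lf tf th x; have [a fa] := tf x; have [b hb] := th x.
exists (b * a); have -> : (f \o h) (yh_basis x) =
    b *: f (yh_basis x) + f (h (yh_basis x) - b *: yh_basis x).
  by rewrite -lf addrC subrK.
rewrite addrAC -scalerA -scalerBr; apply: lspanD; first exact: lspanZ.
exact: triangular_longer.
Qed.

Lemma triangular_scale a : triangular ( *:%R a).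
Proof. by move=> x; exists a; rewrite subrr; apply: lspan0. Qed.

Lemma basis_tl c w j :
  t j * yh_basis (c, w) = colour_root zeta c j *: yh_basis (c, w).
Proof. by rewrite /yh_basis mulrA idem_tl -scalerAl. Qed.

Lemma basis_tr c w j :
  yh_basis (c, w) * t j = colour_root zeta c (w j) *: yh_basis (c, w).
Proof.
by rewrite /yh_basis /= idem_gw -mulrA idem_tr -scalerAr colour_root_act.
Qed.

Lemma basis_gl_up c w i : (w^-1 (ord_lo i) < w^-1 (ord_hi i))%g%N ->
  g i * yh_basis (c, w) = yh_basis (colour_act (srefl i) c, w * srefl i)%g.
Proof. by move=> up; rewrite /yh_basis /= mulrA g_idem -mulrA gw_up_left. Qed.

(** Here w = s_i w' is reduced, so that g_i g_w = g_i^2 g_w' = - e_i g_w. *)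
Lemma basis_gl_down c w i : (w^-1 (ord_hi i) < w^-1 (ord_lo i))%g%N ->
  g i * yh_basis (c, w) =
  - (if c (ord_lo i) == c (ord_hi i) then yh_basis (c, w) else 0).
Proof.
move=> dn; have up :
    ((w * srefl i)^-1 (ord_lo i) < (w * srefl i)^-1 (ord_hi i))%g%N.
  by rewrite invMg sreflV !permM srefl_lo srefl_hi.
have gwE : YH_gw K r w = g i * YH_gw K r (w * srefl i)%g.
  by rewrite gw_up_left // -mulgA srefl2 mulg1.
have ggw : g i * YH_gw K r w = - (YH_e r t i * YH_gw K r w).
  by rewrite {1}gwE mulrA -expr2 (YH_quad rels) mulNr -mulrA -gwE.
rewrite /yh_basis /= mulrA g_idem -mulrA ggw mulrN mulrA idem_e.
rewrite !ffunE srefl_lo srefl_hi eq_sym.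
case: eqP => [e|_]; last by rewrite mul0r.
congr (- (idem _ * _)); apply/ffunP=> j; rewrite ffunE /srefl.
by case: tpermP => [->|->|].
Qed.

Lemma basis_gr_up c w i : (w (ord_lo i) < w (ord_hi i))%N ->
  yh_basis (c, w) * g i = yh_basis (c, srefl i * w)%g.
Proof. by move=> up; rewrite /yh_basis /= -mulrA gw_up_right. Qed.

(** Here w = w' s_i is reduced, and e_i reaches the idempotent once the latter
    is moved to the right of g_w'. *)
Lemma basis_gr_down c w i : (w (ord_hi i) < w (ord_lo i))%N ->
  yh_basis (c, w) * g i =
  - (if c (w (ord_lo i)) == c (w (ord_hi i)) then yh_basis (c, w) else 0).
Proof.
move=> dn; have up :
    ((srefl i * w)%g (ord_lo i) < (srefl i * w)%g (ord_hi i))%N.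
  by rewrite !permM srefl_lo srefl_hi.
have gwE : YH_gw K r w = YH_gw K r (srefl i * w)%g * g i.
  by rewrite gw_up_right // sreflKg.
have gwg : YH_gw K r w * g i =
    - (YH_gw K r (srefl i * w)%g * (YH_e r t i * g i)).
  by rewrite gwE -mulrA -expr2 (YH_quad rels) mulrN.
rewrite /yh_basis /= -mulrA gwg mulrN mulrA (idem_gw c (_ * w)%g) -mulrA
  (mulrA (idem _)).
rewrite idem_e.
rewrite !ffunE !permM srefl_lo srefl_hi eq_sym.
case: eqP => _; last by rewrite mul0r mulr0.
by rewrite mulrA -idem_gw -mulrA -gwE.
Qed.

Lemma mull_linear y : linear ( *%R y : Y -> Y).
Proof. by move=> a u v; rewrite mulrDr scalerAr. Qed.
Lemma mulr_linear y : linear ( *%R^~ y : Y -> Y).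
Proof. by move=> a u v; rewrite mulrDl scalerAl. Qed.

Lemma triangular_mull y : triangular ( *%R y).
Proof.
elim/YH_ind: y => [j [c w]|i [c w]|a x|x y tx ty|x y tx ty].
- by exists (colour_root zeta c j); rewrite basis_tl subrr; apply: lspan0.
- case/orP: (up_or_down i w^-1%g) => [up|dn].
    exists 0; rewrite scale0r subr0 basis_gl_up //; apply: longer_basis.
    by rewrite /= -(lenV (_ * _)%g) invMg sreflV len_srefl_up ?lenV.
  rewrite basis_gl_down //; case: eqP => _.
    by exists (-1); rewrite scaleN1r opprK addNr; apply: lspan0.
  by exists 0; rewrite scale0r !oppr0 addr0; apply: lspan0.
- by have [b xb] := triangular_scale a x; exists b; rewrite -scalerAl mul1r.
- by move=> z; have [b zb] := triangularD tx ty z; exists b; rewrite mulrDl.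
- move=> z; have [b zb] := triangular_comp (mull_linear x) tx ty z.
  by exists b; rewrite -mulrA.
Qed.

Lemma triangular_mulr y : triangular ( *%R^~ y).
Proof.
elim/YH_ind: y => [j [c w]|i [c w]|a x|x y tx ty|x y tx ty].
- by exists (colour_root zeta c (w j)); rewrite basis_tr subrr; apply: lspan0.
- case/orP: (up_or_down i w) => [up|dn].
    exists 0; rewrite scale0r subr0 basis_gr_up //; apply: longer_basis.
    by rewrite /= len_srefl_up.
  rewrite basis_gr_down //; case: eqP => _.
    by exists (-1); rewrite scaleN1r opprK addNr; apply: lspan0.
  by exists 0; rewrite scale0r !oppr0 addr0; apply: lspan0.
- by have [b xb] := triangular_scale a x; exists b; rewrite -scalerAr mulr1.
- by move=> z; have [b zb] := triangularD tx ty z; exists b; rewrite mulrDr.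
- move=> z; have [b zb] := triangular_comp (mulr_linear y) ty tx z.
  by exists b; rewrite mulrA.
Qed.

Lemma yh_spanning y : longer 0 y.
Proof.
rewrite -[y]mulr1 -sum_idem mulr_sumr.
elim/big_ind: _ => [||c _]; [exact: lspan0 | exact: lspanD |].
have -> : idem c = yh_basis (c, 1%g) by rewrite /yh_basis /= gw1 mulr1.
apply: (triangular_longer (mull_linear y) (@triangular_mull y)).
exact: longer_basis.
Qed.

End YHBasis.

(** * Linear independence by the regular representation *)

Section RegularRepresentation.
Variables (K : fieldType) (r n : nat) (zeta : K).
Hypothesis zeta_prim : r.-primitive_root zeta.
Hypothesis r_neq0 : r%:R != 0 :> K.
Local Notation Y := (YH K r n).
Local Notation t := (@YH_t K r n).
Local Notation g := (@YH_g K r n).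
Implicit Types (i : 'I_n.-1) (j : 'I_n) (w : 'S_n) (s : seq 'I_n.-1).
Implicit Types (c d : {ffun 'I_n -> 'I_r}) (y : Y).

(** The pair (c, w) of the regular representation is the word with letters
    (c (w j), w j). Arbitrary words are allowed because the relations hold for
    them too, and can then be checked on three adjacent letters. *)
Definition cword : Type := 'I_n -> 'I_r * 'I_n.
Implicit Types (x : cword) (phi psi : cword -> K) (u v : YH_term K n).

Definition swap i x : cword := fun j => x (srefl i j).

Definition act_t j phi x : K := zeta ^+ (x j).1 * phi x.
(** The dual of the action of g_i on basis elements: swap an ascent, and at a
    descent multiply by - e_i. *)
Definition act_g i phi x : K :=
  if ((x (ord_lo i)).2 < (x (ord_hi i)).2)%N then phi (swap i x)
  else if (x (ord_lo i)).1 == (x (ord_hi i)).1 then - phi x else 0.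

Fixpoint act u phi : cword -> K :=
  match u with
  | Yt j => act_t j phi
  | Yg i => act_g i phi
  | Yscal a => fun x => a * phi x
  | Yadd u v => fun x => act u phi x + act v phi x
  | Ymul u v => act u (act v phi)
  end.

Lemma act_linear u a phi psi :
  act u (fun x => a * phi x + psi x) = fun x => a * act u phi x + act u psi x.
Proof.
elim: u phi psi => [j|i|b|u IHu v IHv|u IHu v IHv] phi psi /=.
- by apply/funext=> x; rewrite /act_t mulrDr mulrCA.
- apply/funext=> x; rewrite /act_g; case: ifP => _ //; case: ifP => _.
    by rewrite opprD mulrN.
  by rewrite mulr0 addr0.
- by apply/funext=> x; rewrite mulrDr mulrCA.
- by apply/funext=> x; rewrite IHu IHv mulrDr addrACA.
- by rewrite IHv IHu.
Qed.

Lemma act_scal u a phi : act u (fun x => a * phi x) = fun x => a * act u phi x.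
Proof.
have act0 : act u (fun=> 0) = fun=> 0.
  have := act_linear u (-1) (fun=> 0) (fun=> 0).
  rewrite mulr0 addr0 => ->; apply/funext=> x; by rewrite mulN1r addNr.
transitivity (act u (fun x => a * phi x + 0)).
  by congr act; apply/funext=> x; rewrite addr0.
by rewrite act_linear act0; apply/funext=> x; rewrite addr0.
Qed.

Lemma act_exp u (f : cword -> K) m phi x :
  (forall psi x, act u psi x = f x * psi x) ->
  act (Yexp u m) phi x = f x ^+ m * phi x.
Proof. by move=> uf; elim: m => //= m IH; rewrite uf IH mulrA exprS. Qed.

Lemma act_e i phi x :
  act (Ye K r i) phi x = ((x (ord_lo i)).1 == (x (ord_hi i)).1)%:R * phi x.
Proof.
rewrite -(colour_orthogonality zeta_prim r_neq0) -mulrA /=; congr (_ * _).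
have -> m F : act (Ysum m F) phi x = \sum_(k < m) act (F k) phi x.
  rewrite -(big_mkord xpredT (fun k => act (F k) phi x)) /index_iota subn0
    /Ysum.
  by elim: (iota 0 m) => [|s l IH] /=; rewrite ?big_nil ?mul0r ?big_cons ?IH.
rewrite mulr_suml; apply: eq_bigr => s _ /=.
rewrite (act_exp _ _ _ (f := fun x => zeta ^+ (x (ord_lo i)).1)) //.
rewrite (act_exp _ _ _ (f := fun x => (zeta ^+ (x (ord_hi i)).1) ^+ r.-1)).
  by rewrite mulrA exprMn.
move=> psi z.
by rewrite (act_exp _ _ _ (f := fun x => zeta ^+ (x (ord_hi i)).1)).
Qed.

Lemma act_g_comm i i' phi : (i.+1 < i')%N ->
  act_g i (act_g i' phi) = act_g i' (act_g i phi).
Proof.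
move=> far; apply/funext=> x; rewrite /act_g /swap.
have E1 : srefl i (ord_lo i') = ord_lo i' by apply: srefl_fix => /=; lia.
have E2 : srefl i (ord_hi i') = ord_hi i' by apply: srefl_fix => /=; lia.
have E3 : srefl i' (ord_lo i) = ord_lo i by apply: srefl_fix => /=; lia.
have E4 : srefl i' (ord_hi i) = ord_hi i by apply: srefl_fix => /=; lia.
rewrite E1 E2 E3 E4; repeat case: ifP => //= _; rewrite ?oppr0 //.
by congr phi; apply/funext=> j; rewrite -!permM (srefl_commute far).
Qed.

Lemma act_braid i i' phi : i' = i.+1 :> nat ->
  act_g i (act_g i' (act_g i phi)) = act_g i' (act_g i (act_g i' phi)).
Proof.
move=> near; apply/funext=> x.
have E0 : ord_lo i' = ord_hi i by apply: val_inj; rewrite /= near.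
have E1 : srefl i' (ord_lo i) = ord_lo i by apply: srefl_fix => /=; lia.
have E2 : srefl i (ord_hi i') = ord_hi i' by apply: srefl_fix => /=; lia.
have E3 : srefl i' (ord_hi i) = ord_hi i' by rewrite -E0 srefl_lo.
have E4 : srefl i' (ord_hi i') = ord_hi i by rewrite srefl_hi.
have swap_braid : swap i (swap i' (swap i x)) = swap i' (swap i (swap i' x)).
  by apply/funext=> j; rewrite /swap -!permM mulgA (srefl_braid near) mulgA.
rewrite /act_g E0 swap_braid /swap; rewrite ?(E1, E2, E3, E4, srefl_lo,
  srefl_hi).
pose p k := (x k).2; pose q k := (x k).1.
case: (ltngtP (p (ord_lo i)) (p (ord_hi i))) => h1;
  case: (ltngtP (p (ord_hi i)) (p (ord_hi i'))) => h2;
  case: (ltngtP (p (ord_lo i)) (p (ord_hi i'))) => h3; try (exfalso; lia).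
all: case: (eqVneq (q (ord_lo i)) (q (ord_hi i))) => e1 //;
  case: (eqVneq (q (ord_hi i)) (q (ord_hi i'))) => e2 //;
  case: (eqVneq (q (ord_lo i)) (q (ord_hi i'))) => e3 //.
all: rewrite ?oppr0 ?opprK //.
all: try congruence.
all: exfalso; repeat match goal with
  H : is_true (_ != _) |- _ => move/eqP: H => H end; congruence.
Qed.

(** The operators are linear, so the axioms of algebras hold among them; the
    relations between the generators are the ones with content. *)
Lemma act_eq u v : YH_eq r u v -> forall phi, act u phi = act v phi.
Proof.
elim=> {u v} //=.
- by move=> u v w _ uv _ vw phi; rewrite uv vw.
- by move=> u u' v v' _ uu' _ vv' phi; rewrite uu' vv'.
- by move=> u u' v v' _ uu' _ vv' phi; rewrite vv' uu'.
- by move=> u v w phi; apply/funext=> x; rewrite addrA.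
- by move=> u v phi; apply/funext=> x; rewrite addrC.
- by move=> u phi; apply/funext=> x; rewrite mul0r add0r.
- by move=> u phi; apply/funext=> x; rewrite mul1r.
- move=> u v w phi; have := act_linear u 1 (act v phi) (act w phi).
  rewrite (_ : (fun x => _) = (fun x => act v phi x + act w phi x)).
    by move=> ->; apply/funext=> x; rewrite mul1r.
  by apply/funext=> x; rewrite mul1r.
- by move=> u phi; apply/funext=> x; rewrite !mul0r.
- by move=> a b phi; apply/funext=> x; rewrite mulrDl.
- by move=> a b phi; apply/funext=> x; rewrite mulrA.
- by move=> a u phi; rewrite act_scal.
- move=> j phi; apply/funext=> x.
  rewrite (act_exp _ _ _ (f := fun x => zeta ^+ (x j).1)) //.
  by rewrite exprAC (prim_expr_order zeta_prim) expr1n.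
- by move=> j k phi; apply/funext=> x; rewrite /act_t mulrCA.
- move=> i j phi; apply/funext=> x; rewrite /act_g /act_t /swap.
  case: ifP => _ //; case: eqP => e; rewrite ?mulr0 // mulrN; do 3!congr (_ _).
  by rewrite /srefl; case: tpermP => [->|->|//]; rewrite e.
- by move=> i j /orP[] far phi; [|symmetry]; apply: act_g_comm.
- by move=> i j near phi; apply: act_braid.
- move=> i phi; apply/funext=> x; have /= -> := act_e i (act_g i phi) x.
  rewrite /act_g /swap srefl_lo srefl_hi.
  case: ltngtP => // _; case: eqVneq => _; rewrite ?mul0r ?mulr0 ?mul1r
    ?mulN1r ?oppr0 //.
Qed.

Definition yact y phi : cword -> K := act (repr y) phi.

Lemma yact_pi u phi : yact (\pi_Y%qT u) phi = act u phi.
Proof. exact: (act_eq (YH_repr r u)). Qed.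

Lemma yactD y z phi x : yact (y + z) phi x = yact y phi x + yact z phi x.
Proof. by rewrite -[y + z]/(YH_add y z) /YH_add yact_pi. Qed.

Lemma yactM y z phi : yact (y * z) phi = yact y (yact z phi).
Proof. by rewrite -[y * z]/(YH_mul y z) /YH_mul yact_pi. Qed.

Lemma yactZ a y phi x : yact (a *: y) phi x = a * yact y phi x.
Proof.
rewrite -[a *: y]/(YH_mul (YH_scal r n a) y) /YH_mul yact_pi /=.
exact: (congr1 (@^~ x) (yact_pi (Yscal n a) (yact y phi))).
Qed.

Lemma yact_sum (I : finType) (F : I -> Y) phi x :
  yact (\sum_k F k) phi x = \sum_k yact (F k) phi x.
Proof.
apply: (big_morph (fun y => yact y phi x)) => [y z|]; first exact: yactD.
by rewrite -(scale0r 0) yactZ mul0r.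
Qed.

Lemma yact1 phi : yact 1 phi = phi.
Proof.
rewrite -[1]/(YH_scal r n 1) yact_pi /=.
by apply/funext=> x; rewrite mul1r.
Qed.

Lemma yact_t j phi : yact (t j) phi = act_t j phi.
Proof. exact: yact_pi. Qed.

Lemma yact_g i phi : yact (g i) phi = act_g i phi.
Proof. exact: yact_pi. Qed.

Definition base_word c : cword := fun j => (c j, j).
Definition permuted_word c w : cword := fun j => base_word c (w j).

Lemma yact_idem c d phi :
  yact (idem zeta c) phi (base_word d) =
  if c == d then phi (base_word d) else 0.
Proof.
have ne e : e != d -> yact (idem zeta e) phi (base_word d) = 0.
  move=> /eqP ed; have [j zj] : exists j, colour_root zeta e j != colour_root
    zeta d j.
    apply: contrapT => /forallNP h; apply: ed.
    by apply: (colour_root_inj zeta_prim) => j; apply/eqP/negPn/negP/h.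
  have := yactM (t j) (idem zeta e) phi; rewrite (idem_tl zeta_prim) yact_t.
  move=> /(congr1 (@^~ (base_word d))); rewrite yactZ /act_t /= => /eqP.
  rewrite -subr_eq0 -mulrBl mulf_eq0 subr_eq0.
  by rewrite (negPf zj) => /eqP.
case: eqVneq => [->|cd]; last exact: ne.
rewrite -[in RHS](yact1 phi) -(sum_idem n zeta_prim r_neq0) yact_sum.
by rewrite (bigD1 d) //= big1 ?addr0 // => e ed; apply: ne.
Qed.

(** Along a reduced expression every g_i meets an ascent, so only the first
    branch of its action is used. *)
Lemma yact_gw c w phi :
  yact (YH_gw K r w) phi (base_word c) = phi (permuted_word c w).
Proof.
have [s sw /eqP] := shortest_word w; rewrite -sw => {w sw} rs.
rewrite -gw_word //; elim/last_ind: s rs phi => [|s i IH] rs phi.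
  rewrite /YH_gword big_nil yact1 /permuted_word perm_of_word_nil.
  by congr phi; apply/funext=> j; rewrite perm1.
have := rs; rewrite -/(reduced _) reduced_rcons => /andP[rs' up].
rewrite /YH_gword big_rcons /= yactM IH // yact_g /act_g /= up.
by congr phi; apply/funext=> j; rewrite /swap /permuted_word
  perm_of_word_rcons permM.
Qed.

Lemma yact_basis c d w phi : yact (yh_basis zeta (c, w)) phi (base_word d) =
  if c == d then phi (permuted_word d w) else 0.
Proof. by rewrite /yh_basis yactM yact_idem yact_gw. Qed.

(** Evaluating at the word of c the action on the indicator function of the word
    of (c, w) picks the coefficient of b(c, w). *)
Lemma yh_basis_free (a : {ffun 'I_n -> 'I_r} * 'S_n -> K) :
  \sum_p a p *: yh_basis zeta p = 0 -> forall p, a p = 0.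
Proof.
move=> a0 [c w]; pose phi x : K := `[< x = permuted_word c w >]%:R.
have := congr1 (fun y => yact y phi (base_word c)) a0.
rewrite yact_sum -(scale0r 0) yactZ mul0r (bigD1 (c, w)) //= big1 => [|[d u]
  du].
  rewrite addr0 yactZ yact_basis eqxx /phi; case: asboolP => // _.
  by rewrite mulr1.
rewrite yactZ yact_basis; case: eqP => [dc|_]; last by rewrite mulr0.
rewrite /phi; case: asboolP => [uw|_]; last by rewrite mulr0.
case/eqP: du; rewrite dc; congr (_, _); apply/permP=> j.
by have := congr1 (fun x => (x j).2) uw.
Qed.

End RegularRepresentation.

(** * Characters of the torus and the standard basis *)

Section TCharacters.
Variables (K : fieldType) (r n : nat) (zeta : K).
Hypothesis zeta_prim : r.-primitive_root zeta.
Hypothesis r_neq0 : r%:R != 0 :> K.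

(** A scalar solution of the quadratic relation is 0, or -1 if e_i acts by 1. *)
Lemma character_relations (z : 'I_n -> K) (h : pred 'I_n.-1) :
  (forall j, z j ^+ r = 1) -> (forall i, h i -> z (ord_lo i) = z (ord_hi i)) ->
  YH_relations r (z : 'I_n -> K^o)
    (fun i => (if h i then -1 else 0) : K^o).
Proof.
move=> zr hz; split=> //.
- by move=> i j; rewrite mulrC.
- move=> i j; case: ifP => [/hz e|_]; last by rewrite mulr0 mul0r.
  by rewrite mulrC /srefl; case: tpermP => [->|->|]; rewrite ?e.
- by move=> i j _; rewrite mulrC.
- by move=> i j _; do 2!case: ifP => _; rewrite ?mulr0 ?mul0r.
- move=> i; case: ifP => [/hz e|_]; last by rewrite mulr0 oppr0 expr0n.
  rewrite mulrN1 opprK sqrrN expr1n /YH_e.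
  rewrite (eq_bigr (fun=> 1)) => [|s _].
    by rewrite sumr_const card_ord -[RHS]/(_ * _) mulVf.
  rewrite e -exprMn -exprS prednK ?zr ?expr1n //.
  exact: prim_order_gt0 zeta_prim.
Qed.

Lemma character_ext (f f' : {lrmorphism YH K r n -> K^o}) :
  (forall j, f (YH_t K r j) = f' (YH_t K r j)) ->
  (forall i, f (YH_g K r i) = f' (YH_g K r i)) -> f =1 f'.
Proof.
move=> ft fg; elim/YH_ind=> [//|//|a|x y fx fy|x y fx fy].
- by rewrite !linearZ /= !rmorph1.
- by rewrite !rmorphD /= fx fy.
- by rewrite !rmorphM /= fx fy.
Qed.

(** Sending every g_i to 0 extends each colouring to a character of the whole
    algebra, which is then restricted. *)
Lemma IrrT_of_colour (c : {ffun 'I_n -> 'I_r}) :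
  exists chi : IrrT K r n, forall j, chi (YH_Tt K r j) = colour_root zeta c j.
Proof.
have rel := @character_relations (colour_root zeta c) pred0
  (colour_root_exp zeta_prim c) (fun i => False_ind _ \o notF).
have [f [ft _ _]] := YH_lift rel.
pose inT : YH_Tsub K r n -> YH K r n := val.
pose inT_morph : {lrmorphism YH_Tsub K r n -> YH K r n} :=
  HB.pack inT (GRing.RMorphism.on inT) (GRing.Linear.on inT).
by exists (f \o inT_morph) => j; apply: ft.
Qed.

Lemma colour_of_IrrT (chi : IrrT K r n) :
  exists c : {ffun 'I_n -> 'I_r}, forall j, chi (YH_Tt K r j) = colour_root
    zeta c j.
Proof.
have chir j : (chi (YH_Tt K r j) : K) ^+ r = 1.
  rewrite -[LHS](rmorphXn chi).
  rewrite (_ : YH_Tt K r j ^+ r = 1) ?rmorph1 //; apply: val_inj.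
  rewrite rmorphXn rmorph1; exact: (YH_t_exp (YH_gens_relations K r n)).
have /choice[c cE] : forall j, exists k : 'I_r, chi (YH_Tt K r j) = zeta ^+ k.
  by move=> j; have [k ->] := prim_rootP zeta_prim (chir j); exists k.
by exists (finfun c) => j; rewrite cE /colour_root ffunE.
Qed.

Lemma YH_E_colour (chi : IrrT K r n) (c : {ffun 'I_n -> 'I_r}) :
  (forall j, chi (YH_Tt K r j) = colour_root zeta c j) ->
  YH_E chi = idem zeta c.
Proof.
move=> chiE; apply: eq_bigr => j _; congr (_ *: _).
by apply: eq_bigr => s _; rewrite chiE.
Qed.

Lemma E_chi_gw_range :
  [set x : YH K r n | exists (chi : IrrT K r n) (w : 'S_n),
     x = YH_E chi * YH_gw K r w] = range (yh_basis zeta).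
Proof.
apply/seteqP; split=> [_ [chi [w ->]]|_ [[c w] _ <-]].
  have [c /YH_E_colour cE] := colour_of_IrrT chi.
  by exists (c, w) => //; rewrite /yh_basis cE.
have [chi /YH_E_colour cE] := IrrT_of_colour c.
by exists chi, w; rewrite cE.
Qed.

End TCharacters.

Definition coloured_perm (r n : nat) : Type :=
  ({ffun 'I_n -> 'I_r} * 'S_n)%type.

Section ColouredPermOrder.
Variables r n : nat.
HB.instance Definition _ := Finite.on (coloured_perm r n).

Definition shorter : rel (coloured_perm r n) :=
  fun x y => (len x.2 < len y.2)%N.

Fact shorter_irr : irreflexive shorter.
Proof. by move=> x; apply: ltnn. Qed.
Fact shorter_trans : transitive shorter.
Proof. by move=> x y z; apply: ltn_trans. Qed.

HB.instance Definition _ := Order.Lt_isPOrder.Build (Order.Disp tt tt)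
  (coloured_perm r n) shorter_irr shorter_trans.
End ColouredPermOrder.

(** All index sets I and J are singletons, so the scalars of the triangularity
    cannot depend on the wrong index. *)
Lemma standard_basis_yh (K : fieldType) (r n : nat) (zeta : K) :
  r.-primitive_root zeta -> r%:R != 0 :> K ->
  standard_basis (range (@yh_basis K r n zeta)).
Proof.
move=> zeta_prim r_neq0.
pose a (l : coloured_perm r n) (_ _ : unit) := yh_basis zeta l.
have cellE : [set x | exists l, sb_cell a l x] = range (yh_basis zeta).
  apply/seteqP; split=> [x [l [i [j ->]]]|x [l _ <-]]; first by exists l.
  by exists l, tt, tt.
have above (l : coloured_perm r n) :
    longer zeta (len l.2).+1 `<=` sb_above a l.
  apply: lspan_sub => _ [m /= lm <-]; exists m => //; by exists tt, tt.
have [b_inj indep] := lin_indep_range (yh_basis_free (n := n) zeta_prim r_neq0).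
exists _, (coloured_perm r n), (fun=> unit), (fun=> unit), a; split=> //.
- split.
    by move=> [l [[] []]] [l' [[] []]] /= /b_inj e; rewrite e.
  split; rewrite cellE //.
  apply/seteqP; split=> // x _.
  have := yh_spanning zeta_prim r_neq0 x; apply: lspan_sub.
  by move=> _ [l _ <-]; exists l.
- pose f (y : YH K r n) := choice (triangular_mull zeta_prim r_neq0 y).
  exists (fun l y _ _ => projT1 (f y) l) => y l i; split; first exact:
    finite_finset.
  move=> j; rewrite (_ : setT = [set tt]); last first.
    by apply/seteqP; split=> // -[].
  by rewrite fsbig_set1; apply: above (projT2 (f y) l).
- pose f (y : YH K r n) := choice (triangular_mulr zeta_prim r_neq0 y).
  exists (fun l _ y _ => projT1 (f y) l) => y l j; split; first exact:
    finite_finset.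
  move=> i; rewrite (_ : setT = [set tt]); last first.
    by apply/seteqP; split=> // -[].
  by rewrite fsbig_set1; apply: above (projT2 (f y) l).
Qed.

(** * One-dimensional modules *)

Definition char_module (K : fieldType) (A : algType K)
  (f : {lrmorphism A -> K^o}) : Type := K.

Section CharModule.
Variables (K : fieldType) (A : algType K) (f : {lrmorphism A -> K^o}).
HB.instance Definition _ := GRing.Zmodule.copy (char_module f) K.

Definition char_scale (a : A) (v : char_module f) : char_module f :=
  (f a : K) * (v : K).

Fact char_scalerA a b v : char_scale a (char_scale b v) = char_scale (a * b) v.
Proof. by rewrite /char_scale mulrA rmorphM. Qed.
Fact char_scale1r : left_id 1 char_scale.
Proof. by move=> v; rewrite /char_scale rmorph1; apply: mul1r. Qed.
Fact char_scalerDr : right_distributive char_scale +%R.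
Proof. by move=> a u v; apply: mulrDr. Qed.
Fact char_scalerDl v : {morph char_scale^~ v : a b / a + b}.
Proof. by move=> a b; rewrite /char_scale rmorphD; apply: mulrDl. Qed.

HB.instance Definition _ := GRing.Zmodule_isLmodule.Build A (char_module f)
  char_scalerA char_scale1r char_scalerDr char_scalerDl.
End CharModule.

Section OneDimensionalModules.
Variables (K : fieldType) (A : algType K).
Implicit Types (V : lmodType A) (f : {lrmorphism A -> K^o}).

Lemma algr_scalar f (k : K) : f k%:A = k.
Proof. by rewrite linearZ /= rmorph1; apply: mulr1. Qed.

Lemma scale_algA V (k : K) (a : A) (v : V) : (k *: a) *: v = k%:A *: (a *: v).
Proof. by rewrite scalerA mulr_algl. Qed.

Lemma scale_algM V (k l : K) (v : V) : (k * l)%:A *: v = k%:A *: (l%:A *: v).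
Proof. by rewrite -scale_algA scalerA. Qed.

Lemma scale_algC V (a : A) (k : K) (v : V) :
  a *: (k%:A *: v) = k%:A *: (a *: v).
Proof. by rewrite scalerA mulr_algr scale_algA. Qed.

Lemma alg_scale_eq0 V (u : V) (k : K) : u != 0 -> k%:A *: u = 0 -> k = 0.
Proof.
move=> u0 ku; apply/eqP; apply: contraNT u0 => k0.
by rewrite -[u]scale1r -(scale1r 1) -(mulVf k0) scale_algM ku scaler0.
Qed.

Lemma alg_scale_inj V (u : V) (k l : K) : u != 0 -> k%:A *: u = l%:A *: u -> k
  = l.
Proof.
move=> u0 kl; apply/eqP; rewrite -subr_eq0; apply/eqP.
by apply: (alg_scale_eq0 u0); rewrite !scalerBl kl subrr.
Qed.

Definition spans V (u : V) : Prop := forall v : V, exists k : K, v = k%:A *: u.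

Lemma has_dim1 V (u : V) : u != 0 -> spans u -> has_dim (res_scalars V) 1.
Proof.
move=> u0 sp; exists (fun=> u : res_scalars V); split; last split.
- by move=> i j _; rewrite !ord1.
- move=> m c v vu v_inj s0 i.
  have vE k : v k = u by have [_ _ <-] := vu k.
  move: s0; rewrite (bigD1 i) //= big1 ?addr0 => [|k /eqP ki]; last first.
    by case: ki; apply: v_inj; rewrite !vE.
  by rewrite vE; apply: alg_scale_eq0.
- apply/seteqP; split=> // v _; have [k ->] := sp v.
  by apply: (@lspanZ _ (res_scalars V)); apply: mem_lspan; exists ord0.
Qed.

Lemma spanned_by_eigenvector V (u : V) :
  simple_module V -> u != 0 -> (forall a : A, exists k : K, a *: u = k%:A *:
    u) ->
  spans u.
Proof.
move=> [_ simV] u0 eig.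
pose S : {pred V} := fun v => `[< exists k : K, v = k%:A *: u >].
have SC : submod_closed S.
  split; first by apply/asboolP; exists 0; rewrite !scale0r.
  move=> a x y /asboolP[k ->] /asboolP[l ->]; have [m am] := eig a.
  apply/asboolP; exists (k * m + l); rewrite !scalerDl; congr (_ + _).
  by rewrite scale_algC am scale_algM.
have [z|all_in] := simV S SC.
  by have /eqP := u0; case; apply: z; apply/asboolP; exists 1; rewrite !scale1r.
by move=> v; have /asboolP := all_in v.
Qed.

Lemma eigen_character V (u : V) :
  u != 0 -> (forall a : A, exists k : K, a *: u = k%:A *: u) ->
  exists f, forall a, a *: u = (f a : K)%:A *: u.
Proof.
move=> u0 /choice[f fE].
have fL (a : K) (x y : A) : f (a *: x + y) = a * f x + f y.
  apply: (alg_scale_inj u0); rewrite -fE !scalerDl -(fE y); congr (_ + _).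
  by rewrite scale_algA fE scale_algM.
have fM (x y : A) : f (x * y) = f x * f y.
  apply: (alg_scale_inj u0); rewrite -fE -scalerA (fE y) scale_algC fE.
  by rewrite mulrC scale_algM.
have f1 : f 1 = 1 by apply: (alg_scale_inj u0); rewrite -fE !scale1r.
pose fl := GRing.isLinear.Build K A K^o *:%R f fL.
pose fm := GRing.isMonoidMorphism.Build A K^o f (conj f1 fM).
pose F : {lrmorphism A -> K^o} := HB.pack (f : A -> K^o) fl fm.
by exists F.
Qed.

Lemma eigen_mod_iso V (u : V) f : u != 0 -> spans u ->
  (forall a, a *: u = (f a : K)%:A *: u) -> mod_iso V (char_module f).
Proof.
move=> u0 /choice[h hE] uf; pose h' : V -> char_module f := h.
have hL a x y : h' (a *: x + y) = a *: h' x + h' y.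
  apply: (alg_scale_inj u0); rewrite -[h' _]/(h _) -hE.
  rewrite -[RHS]/((f a * h x + h y : K)%:A *: u) !scalerDl -hE; congr (_ + _).
  by rewrite {1}(hE x) scale_algC uf mulrC scale_algM.
pose H : {linear V -> char_module f} :=
  HB.pack h' (GRing.isLinear.Build A V (char_module f) *:%R h' hL).
exists H; exists (fun k : char_module f => (k : K)%:A *: u) => [x|k] /=.
  by rewrite -hE.
by apply: (alg_scale_inj u0); rewrite -hE.
Qed.

Lemma char_module_spanned f (u : char_module f) : u != 0 -> spans u.
Proof.
move=> u0 v; exists ((v : K) / (u : K)).
rewrite -[RHS]/(f _ * (u : K)) algr_scalar.
by rewrite -mulrA mulVf ?mulr1.
Qed.

Lemma char_module_simple f : simple_module (char_module f).
Proof.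
split; first by exists (1 : K); apply: oner_neq0.
move=> S [S0 SL]; have [[v Sv v0]|none] := pselect (exists2 v, v \in S & v !=
  0).
  right=> w; have [k ->] := char_module_spanned v0 w.
  by have := SL k%:A v 0 Sv S0; rewrite addr0.
left=> v Sv; apply/eqP/negPn/negP => v0; case: none; by exists v.
Qed.

Lemma char_module_scale f (a : A) (v : char_module f) :
  a *: v = (f a : K)%:A *: v.
Proof. by rewrite -[RHS]/(f _ * (v : K)) algr_scalar. Qed.

(** Both characters describe the action on the image of 1. *)
Lemma char_module_iso f f' :
  mod_iso (char_module f) (char_module f') -> f =1 f'.
Proof.
move=> [h h_bij] a; pose one : char_module f := (1 : K).
have h1 : h one != 0.
  by rewrite -(linear0 h) (inj_eq (bij_inj h_bij)); apply: oner_neq0.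
by apply: (alg_scale_inj h1); rewrite -linearZ -!char_module_scale -linearZ.
Qed.

End OneDimensionalModules.

(** Take b(c, w) v nonzero with w of maximal length. By triangularity
    y b(c, w) is a multiple of b(c, w) plus longer basis elements, which kill
    v. *)
Lemma simple_eigenvector (K : fieldType) (r n : nat) (zeta : K)
    (V : lmodType (YH K r n)) :
  r.-primitive_root zeta -> r%:R != 0 :> K -> simple_module V ->
  exists2 u : V, u != 0 &
    forall y : YH K r n, exists k : K, y *: u = k%:A *: u.
Proof.
move=> zeta_prim r_neq0 [[v v0] _].
have kill m : (forall p, (m <= len p.2)%N -> yh_basis zeta p *: v = 0) ->
    forall y : YH K r n, longer zeta m y -> y *: v = 0.
  move=> bv; apply: lspan_ind => [|x y xv yv|a x xv|_ [p mp <-]].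
  - by rewrite scale0r.
  - by rewrite scalerDl xv yv addr0.
  - by rewrite scale_algA xv scaler0.
  - exact: bv.
have [p0 p0v] : exists p, yh_basis zeta p *: v != 0.
  apply: contrapT => /forallNP none; case/eqP: v0; rewrite -[v]scale1r.
  apply: (kill 0) (yh_spanning zeta_prim r_neq0 1) => p _.
  by apply/eqP/negPn/negP/none.
pose P (p : {ffun 'I_n -> 'I_r} * 'S_n) := yh_basis zeta p *: v != 0.
case: (@arg_maxnP _ p0 P (fun p => len p.2) p0v) => p pv pmax.
exists (yh_basis zeta p *: v) => // y.
have [k yk] := triangular_mull zeta_prim r_neq0 y p.
exists k; apply/eqP; rewrite -subr_eq0 -scale_algA scalerA -scalerBl.
apply/eqP; apply: kill yk => q pq; apply/eqP/negPn/negP => qv.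
by have /(leq_trans pq) := pmax q qv; rewrite ltnn.
Qed.

Lemma simple_yh (K : fieldType) (r n : nat) (zeta : K) (V : lmodType (YH K r
  n)) :
  r.-primitive_root zeta -> r%:R != 0 :> K -> simple_module V ->
  has_dim (res_scalars V) 1 /\
  exists f : {lrmorphism YH K r n -> K^o},
    forall f' : {lrmorphism YH K r n -> K^o}, f =1 f' -> mod_iso V
      (char_module f').
Proof.
move=> zeta_prim r_neq0 simV.
have [u u0 eig] := simple_eigenvector zeta_prim r_neq0 simV.
have sp := spanned_by_eigenvector simV u0 eig.
split; first exact: has_dim1 u0 sp.
have [f uf] := eigen_character u0 eig.
exists f => f' ff'; apply: (eigen_mod_iso u0 sp) => a.
by rewrite uf ff'.
Qed.

(** * Compositions as cuts *)

Section Compositions.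
Implicit Types (F J : seq nat) (b : seq bool) (Js : seq (seq nat)).

(** When F is a composition, this is the indicator sequence of its partial sums:
    the entry at i, counted from 0, tells whether a part ends just after i. *)
Definition cuts F : seq bool :=
  flatten [seq rcons (nseq p.-1 false) true | p <- F].

Lemma cuts_cons p F : cuts (p :: F) = nseq p.-1 false ++ true :: cuts F.
Proof. by rewrite /cuts /= cat_rcons. Qed.

Lemma cuts_cat F F' : cuts (F ++ F') = cuts F ++ cuts F'.
Proof. by rewrite /cuts map_cat flatten_cat. Qed.

Definition all_pos F := all (fun p => 0 < p)%N F.

Lemma size_cuts F : all_pos F -> size (cuts F) = sumn F.
Proof.
elim: F => //= p F IH /andP[p0 F0].
by rewrite cuts_cons size_cat size_nseq /= IH // addnS -addSn prednK.
Qed.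

Lemma last_cuts F : last true (cuts F) = true.
Proof. by elim: F => // p F IH; rewrite cuts_cons last_cat. Qed.

Lemma cuts_inj F F' : all_pos F -> all_pos F' -> cuts F = cuts F' -> F = F'.
Proof.
have index_cuts m b : index true (nseq m false ++ true :: b) = m.
  by elim: m => //= m ->.
elim: F F' => [|p F IH] [|q F'] //=; rewrite ?cuts_cons.
- by move=> _ _ /(congr1 size); rewrite size_cat /= addnS.
- by move=> _ _ /(congr1 size); rewrite size_cat /= addnS.
move=> /andP[p0 F0] /andP[q0 F0'] e.
have := congr1 (index true) e; rewrite !index_cuts => pq.
move/eqP: e; rewrite pq eqseq_cat // => /andP[_ /eqP[/(IH _ F0 F0') ->]].
by rewrite -(prednK p0) pq prednK.
Qed.

Lemma cuts_surj b : last true b = true -> exists2 F, all_pos F & cuts F = b.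
Proof.
elim: b => [|b0 b IH]; first by exists [::].
case: b0 => /= lb.
  by have [F F0 <-] := IH lb; exists (1%N :: F) => //; rewrite cuts_cons.
have [|F F0 Fb] := IH; first by case: (b) lb.
case: F F0 Fb => [_ bE|p F /= /andP[p0 F0] <-]; first by rewrite -bE in lb.
by exists (p.+1 :: F) => //; rewrite !cuts_cons /= -{1}(prednK p0).
Qed.

Variables (T : eqType) (x0 : T).
Implicit Types (B : seq (seq T)).

Local Notation compositions B Js :=
  (all2 (fun bl J => is_composition (size bl) J) B Js).

Lemma compositions_flatten B Js : compositions B Js ->
  all_pos (flatten Js) /\ sumn (flatten Js) = size (flatten B).
Proof.
elim: B Js => [|bl B IH] [|J Js] //= /andP[/andP[J0 /eqP sJ]] /IH[Js0 sJs].
by rewrite /all_pos all_cat J0 sumn_cat size_cat sJ sJs; split.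
Qed.

Lemma compositions_size B Js : compositions B Js ->
  size (cuts (flatten Js)) = size (flatten B).
Proof. by move=> /compositions_flatten[/size_cuts -> ->]. Qed.

Lemma compositions_inj B Js Js' : compositions B Js -> compositions B Js' ->
  flatten Js = flatten Js' -> Js = Js'.
Proof.
have prefix_eq J J' F F' : all_pos J -> all_pos J' -> sumn J = sumn J' ->
    J ++ F = J' ++ F' -> J = J' /\ F = F'.
  elim: J J' => [|p J IH] [|q J'] //=.
  - by move=> _ /andP[q0 _]; case: q q0.
  - by move=> /andP[p0 _]; case: p p0.
  move=> /andP[_ J0] /andP[_ J0'] s [e]; move: s; rewrite e => /addnI s JF.
  by have [-> ->] := IH _ J0 J0' s JF.
elim: B Js Js' => [|bl B IH] [|J Js] [|J' Js'] //=.
move=> /andP[/andP[J0 /eqP sJ] cJ] /andP[/andP[J0' /eqP sJ'] cJ'] e.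
have [|-> /(IH _ _ cJ cJ') -> //] := prefix_eq _ _ _ _ J0 J0' _ e.
by rewrite sJ sJ'.
Qed.

Definition cuts_at_changes (s : seq T) b := forall i, (i.+1 < size s)%N ->
  ~~ nth true b i -> nth x0 s i = nth x0 s i.+1.

Lemma constant_nth (s : seq T) i j : constant s ->
  (i < size s)%N -> (j < size s)%N -> nth x0 s i = nth x0 s j.
Proof. by case/(constantP x0)=> x ->; rewrite size_nseq !nth_nseq => -> ->. Qed.

Lemma compositions_cut B Js : all (@constant T) B -> compositions B Js ->
  cuts_at_changes (flatten B) (cuts (flatten Js)).
Proof.
elim: B Js => [|bl B IH] [|J Js] //= /andP[cbl cB] /andP[/andP[J0 /eqP sJ] cJ]
  i.
rewrite size_cat cuts_cat !nth_cat size_cuts // sJ.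
move=> isz; case: (ltnP i (size bl)) => ibl.
  case: (ltnP i.+1 (size bl)) => [i1bl _|ibl']; first exact: constant_nth.
  have -> : nth true (cuts J) i = true.
    by rewrite -[RHS](last_cuts J) -nth_last size_cuts // sJ;
      congr nth; lia.
  by [].
rewrite ltnNge leqW //= subSn //; apply: IH => //; lia.
Qed.

(** Consecutive blocks carry different letters, so b has a cut at the end of
    each block and its restriction to a block is the cut sequence of a
    composition. *)
Lemma compositions_exist B b :
  (forall bl, bl \in B -> bl != [::] /\ constant bl) ->
  sorted (fun bl bl' => last x0 bl != head x0 bl') B ->
  size b = size (flatten B) -> last true b = true ->
  cuts_at_changes (flatten B) b ->
  exists2 Js, compositions B Js & cuts (flatten Js) = b.
Proof.
elim: B b => [|bl B IH] b Bbl Bs /=; first by case: b => // _ _ _; exists [::].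
rewrite size_cat => sb lb cb.
have [bl0 cbl] := Bbl bl (mem_head _ _).
have szbl : (0 < size bl)%N by case: (bl) bl0.
pose b1 := take (size bl) b; pose b2 := drop (size bl) b.
have bE : b = b1 ++ b2 by rewrite cat_take_drop.
have sb1 : size b1 = size bl by rewrite size_takel // sb leq_addr.
have sb2 : size b2 = size (flatten B) by rewrite size_drop sb addKn.
have lb2 : last true b2 = true.
  by move: lb; rewrite bE last_cat; case: (b2) => //.
have lb1 : last true b1 = true.
  case: B Bbl Bs sb cb sb2 {IH} => [|bl' B] Bbl Bs sb cb sb2.
    by move: lb; rewrite bE (size0nil sb2) cats0.
  have [bl'0 _] : bl' != [::] /\ constant bl' by apply: Bbl; rewrite !inE eqxx
    orbT.
  have := cb (size bl).-1; rewrite prednK // size_cat -[X in (X < _)%N]addn0.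
  rewrite ltn_add2l size_cat ltn_addr ?lt0n ?size_eq0 // => /(_ isT).
  rewrite !nth_cat ltnn subnn prednK // leqnn bE nth_cat sb1 prednK // leqnn.
  rewrite nth_last -sb1 nth_last; case: (last true b1) => // /(_ isT) e.
  move: Bs e => /= /andP[/eqP lh _]; rewrite lt0n size_eq0 bl'0 nth0 => e.
  by case: lh; rewrite -e.
have [J J0 Jb1] := cuts_surj lb1.
have [|||||Js cJs Jsb2] := IH b2; rewrite ?sb2 ?lb2 //.
- by move=> bl' Bbl'; apply: Bbl; rewrite inE Bbl' orbT.
- by case: (B) Bs => //= ? ? /andP[].
- move=> i isz; have := cb (size bl + i)%N.
  rewrite size_cat -addnS ltn_add2l {1}bE !nth_cat sb1 => /(_ isz).
  by rewrite !ltnNge !leq_addr /= !addKn.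
exists (J :: Js); last by rewrite cuts_cat Jb1 Jsb2.
by rewrite /= cJs andbT /is_composition -/(all_pos J) J0 -size_cuts // Jb1 sb1
  eqxx.
Qed.

End Compositions.

(** * Primitive roots of unity *)

(** X^r - 1 is separable, so its r roots are distinct, and a finite group of
    roots of unity is cyclic. *)
Lemma exists_prim_root (K : closedFieldType) (r : nat) :
  (0 < r)%N -> r%:R != 0 :> K -> exists zeta : K, r.-primitive_root zeta.
Proof.
move=> r_gt0 r_neq0; pose p : {poly K} := 'X^r - 1.
have [rs Dp] := closed_field_poly_normal p.
rewrite (monicP _) ?monicXnsubC // scale1r in Dp.
have rs_root : all r.-unity_root rs.
  by apply/allP=> z; rewrite -root_prod_XsubC -Dp.
have rs_size : (r < (size rs).+1)%N.
  by rewrite -(size_prod_XsubC rs id) -Dp size_XnsubC.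
have [|z] := hasP (has_prim_root r_gt0 rs_root _ rs_size); last by exists z.
by rewrite -separable_prod_XsubC -Dp separable_Xn_sub_1.
Qed.

(** * Characters and their indices *)

Section CharacterIndex.
Variables (K : fieldType) (r n : nat) (zeta : K).
Hypothesis n_gt0 : (0 < n)%N.
Hypothesis zeta_prim : r.-primitive_root zeta.
Hypothesis r_neq0 : r%:R != 0 :> K.
Implicit Types x : simple_index r n.
Local Notation character := {lrmorphism YH K r n -> K^o}.

Definition index_colour x : {ffun 'I_n -> 'I_r} :=
  [ffun j => tnth (val x).1 j].

Definition index_cuts x : seq bool := cuts (flatten (val x).2).

Definition affords x (f : character) : Prop :=
  (forall j, f (YH_t K r j) = colour_root zeta (index_colour x) j) /\
  (forall i, f (YH_g K r i) = if nth true (index_cuts x) i then 0 else -1).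

Lemma size_index_cuts x : size (index_cuts x) = n.
Proof.
pose x0 := tnth (val x).1 (Ordinal n_gt0).
rewrite /index_cuts (compositions_size (valP x)).
by have [-> _ _] := blocksP (val x).1 x0; rewrite size_tuple.
Qed.

Lemma index_cuts_at_changes x i : ~~ nth true (index_cuts x) (i : 'I_n.-1) ->
  index_colour x (ord_lo i) = index_colour x (ord_hi i).
Proof.
pose x0 := tnth (val x).1 (Ordinal n_gt0).
have [fl bl _] := blocksP (val x).1 x0.
have allc : all (@constant _) (blocks (val x).1).
  by apply/allP=> b /bl[].
have := @compositions_cut _ x0 _ _ allc (valP x) i.
rewrite fl size_tuple ord_hi_subproof => /(_ isT) h /h.
by rewrite !ffunE !(tnth_nth x0).
Qed.

Lemma exists_affords x : exists f, affords x f.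
Proof.
have rel := @character_relations K r n zeta zeta_prim r_neq0
  (colour_root zeta (index_colour x)) (fun i => ~~ nth true (index_cuts x) i)
  (colour_root_exp zeta_prim _).
have [|f [ft fg _]] := YH_lift (rel _).
  by move=> i /index_cuts_at_changes; rewrite /colour_root => ->.
by exists f; split=> // i; rewrite fg if_neg.
Qed.

Lemma affords_inj x y f f' : affords x f -> affords y f' -> f =1 f' -> x = y.
Proof.
move=> [xt xg] [yt yg] ff'.
have col : (val x).1 = (val y).1.
  have : index_colour x = index_colour y.
    by apply: (colour_root_inj zeta_prim) => j; rewrite -xt -yt.
  by move=> /ffunP e; apply: eq_from_tnth => j; have := e j; rewrite !ffunE.
have cut : index_cuts x = index_cuts y.
  apply: (@eq_from_nth _ true); rewrite !size_index_cuts // => k kn.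
  have [kn'|kn'] := ltnP k n.-1.
    have /eqP : f (YH_g K r (Ordinal kn')) = f (YH_g K r (Ordinal kn')) by [].
    rewrite {2}ff' xg yg /=.
    by do 2!case: nth => //; rewrite ?[0 == _]eq_sym oppr_eq0 oner_eq0.
  have -> : k = n.-1 by lia.
  rewrite -{1}(size_index_cuts x) -(size_index_cuts y) !nth_last.
  by rewrite !last_cuts.
have cx := valP x; have cy := valP y; rewrite /is_simple_index -col in cx cy.
apply: val_inj; rewrite [LHS]surjective_pairing [RHS]surjective_pairing col.
congr (_, _); apply: (compositions_inj cx cy).
have [px _] := compositions_flatten cx; have [py _] := compositions_flatten cy.
exact: cuts_inj px py cut.
Qed.

Lemma character_colour (f : character) : exists c : {ffun 'I_n -> 'I_r},
  forall j, f (YH_t K r j) = colour_root zeta c j.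
Proof.
have /choice[c cE] j : exists k : 'I_r, f (YH_t K r j) = zeta ^+ k.
  have fr : (f (YH_t K r j) : K) ^+ r = 1.
    by rewrite -[LHS](rmorphXn f) (YH_t_exp (YH_gens_relations K r n)) rmorph1.
  by have [k ->] := prim_rootP zeta_prim fr; exists k.
by exists (finfun c) => j; rewrite cE /colour_root ffunE.
Qed.

(** Evaluating the quadratic relation: e_i is sent to 1 if the colours agree
    and to 0 otherwise, so x = f(g_i) satisfies x^2 = - x, respectively x^2 = 0. *)
Lemma character_g (f : character) (c : {ffun 'I_n -> 'I_r}) i :
  (forall j, f (YH_t K r j) = colour_root zeta c j) ->
  f (YH_g K r i) <> 0 -> f (YH_g K r i) = -1 /\ c (ord_lo i) = c (ord_hi i).
Proof.
move=> fc g0; have rels := YH_gens_relations K r n.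
have fe : f (YH_e r (@YH_t K r n) i) = (c (ord_lo i) == c (ord_hi i))%:R.
  rewrite -(colour_orthogonality zeta_prim r_neq0) /YH_e linearZ /= rmorph_sum.
  congr (_ * _); apply: eq_bigr => s _.
  by rewrite rmorphM !rmorphXn /= !fc exprMn.
have /eqP : f (YH_g K r i) ^+ 2 =
    - (f (YH_e r (@YH_t K r n) i) * f (YH_g K r i)).
  by rewrite -rmorphXn (YH_quad rels) rmorphN rmorphM.
rewrite expr2 -mulNr -subr_eq0 -mulrBl mulf_eq0 => /orP[|/eqP //].
rewrite opprK fe; case: (c (ord_lo i) =P _) => [-> |_]; last by rewrite addr0
  => /eqP.
by rewrite addr_eq0 => /eqP.
Qed.

Lemma exists_index (f : character) : exists x, affords x f.
Proof.
have [c fc] := character_colour f.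
pose s : n.-tuple 'I_r := [tuple c j | j < n].
pose x0 := c (Ordinal n_gt0).
(* the last entry of b is true because no i reaches n - 1 *)
pose b := mkseq (fun k =>
  [forall i : 'I_n.-1, (i == k :> nat) ==> (f (YH_g K r i) == 0)]) n.
have bE (i : 'I_n.-1) : nth true b i = (f (YH_g K r i) == 0).
  have ltin : (i < n)%N by have := ltn_ord i; lia.
  rewrite nth_mkseq //; apply/forallP/idP => [/(_ i)|fi k]; first by rewrite
    eqxx.
  by apply/implyP=> /eqP/val_inj ->.
have sE (j : 'I_n) : nth x0 s j = c j by rewrite -tnth_nth tnth_mktuple.
have [fl bl bs] := blocksP s x0.
have [|||Js cJs cutJ] := @compositions_exist _ x0 _ b bl bs.
- by rewrite fl size_mkseq size_tuple.
- rewrite -nth_last size_mkseq nth_mkseq ?prednK //.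
  by apply/forallP=> i; apply/implyP=> /eqP e; have := ltn_ord i; rewrite e
    ltnn.
- move=> i; rewrite fl size_tuple => isz.
  have ilt : (i < n.-1)%N by lia.
  rewrite (bE (Ordinal ilt)) => /eqP/(character_g fc)[_].
  by rewrite -(sE (ord_lo _)) -(sE (ord_hi _)).
exists (exist _ (s, Js) cJs); split=> [j|i].
  by rewrite fc /colour_root ffunE /= tnth_mktuple.
rewrite /index_cuts /= cutJ bE; case: eqP => // /(character_g fc)[-> //].
Qed.

End CharacterIndex.

Theorem theorem2p8 (K : closedFieldType) (r n : nat)
    (r_gt0 : (0 < r)%N) (n_gt0 : (0 < n)%N)
    (char_ndvd_r : forall p : nat, p \in [pchar K] -> ~~ (p %| r)%N) :
  standard_basis
    [set x : YH K r n | exists (chi : IrrT K r n) (w : 'S_n),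
       x = YH_E chi * YH_gw K r w]
  /\
  (forall V : lmodType (YH K r n), simple_module V -> has_dim (res_scalars V) 1)
  /\
  (exists L : simple_index r n -> lmodType (YH K r n),
     [/\ forall x, simple_module (L x),
         forall x y, mod_iso (L x) (L y) -> x = y &
         forall V : lmodType (YH K r n), simple_module V ->
           exists x, mod_iso V (L x)]).
Proof.
have r_neq0 : r%:R != 0 :> K.
  rewrite natf_neq0_pchar; apply/pnatP=> // p p_pr pr.
  by apply/negP => /char_ndvd_r; rewrite pr.
have [zeta zeta_prim] := exists_prim_root r_gt0 r_neq0.
split; first by rewrite (E_chi_gw_range n zeta_prim r_neq0); apply:
  standard_basis_yh.
split=> [V simV|]; first by have [] := simple_yh zeta_prim r_neq0 simV.
have [f fP] := choice (exists_affords n_gt0 zeta_prim r_neq0).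
exists (fun x => char_module (f x)); split=> [x|x y|V simV].
- exact: char_module_simple.
- by move=> /char_module_iso; apply: affords_inj (fP x) (fP y).
- have [_ [h Vh]] := simple_yh zeta_prim r_neq0 simV.
  have [x [xt xg]] := exists_index n_gt0 zeta_prim r_neq0 h.
  have [ft fg] := fP x; exists x; apply: Vh.
  by apply: character_ext => k; rewrite ?xt ?ft ?xg ?fg.
Qed.
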